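(* Let $n\ge1$ and consider a classification problem with $m$ classes, where class $c\in\{1,\dots,m\}$ is described by a bounded probability density $\rho_c$ on $[0,1]^n$ (with respect to Lebesgue measure). Let $\mathcal{C}:[0,1]^n\to\{1,\dots,m\}$ be a classifier with measurable level sets, and let $f_c=\mathrm{vol}\{x\in[0,1]^n:\mathcal{C}(x)=c\}$. Choose a class $c$ with $f_c<\frac12$, let $p\ge 0$, set $p^*=\min(p,2)$ (for $p>0$), and let $\epsilon>0$. Let $\mathrm{supp}(\rho_c)=\{x:\rho_c(x)>0\}$. Then there exists a point $x$ with $\rho_c(x)>0$ and a point $\hat x\in[0,1]^n$ with $\mathcal{C}(\hat x)\ne c$ and $\|x-\hat x\|_p\le\epsilon$, provided that $$\mathrm{vol}[\mathrm{supp}(\rho_c)]\ge\frac12\exp\left(-\pi\epsilon^2n^{1-2/p^*}\right)\quad\text{in the case }p>0,$$ or, in the case $p=0$ and $\epsilon\ge\sqrt{n\log2/2}$, $$\mathrm{vol}[\mathrm{supp}(\rho_c)]\ge\exp\left(-\frac{2}{n}\left(\epsilon-\sqrt{\frac{n\log2}{2}}\right)^2\right).$$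
   Context: $\|z\|_p=(\sum_i|z_i|^p)^{1/p}$ for $p>0$ and $\|z\|_0=\#\{i:z_i\ne0\}$; $\mathrm{vol}$ is Lebesgue measure. *)

(* Defs.v *)
From HB Require Import structures.
From mathcomp Require Import all_boot all_order all_algebra.
From mathcomp Require Import all_classical all_reals all_analysis.
Set Implicit Arguments. Unset Strict Implicit. Unset Printing Implicit Defensive.
Import Order.TTheory GRing.Theory Num.Theory.
Import numFieldNormedType.Exports.
Local Open Scope classical_set_scope.
Local Open Scope ring_scope.

(* Points of R^n are n-tuples of reals; n.-tuple R carries the product
   (= Borel) sigma-algebra generated by the coordinates. *)

(* n-dimensional Lebesgue measure on Borel sets of R^n, defined by
   iterated integration (Tonelli):
     lvol_0 A = 1 if the empty tuple is in A, 0 otherwise;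
     lvol_{n+1} A = \int_R lvol_n {t | x :: t \in A} dx. *)
Fixpoint lvol (R : realType) (n : nat) : set (n.-tuple R) -> \bar R :=
  match n return set (n.-tuple R) -> \bar R with
  | 0 => fun A => if `[< A [tuple] >] then 1%E else 0%E
  | k.+1 => fun A =>
      (\int[@lebesgue_measure R]_(x in [set: R])
          @lvol R k [set t : k.-tuple R | A (cons_tuple (x : R) t)])%E
  end.

Definition lnull (R : realType) (n : nat) (A : set (n.-tuple R)) : Prop :=
  exists N : set (n.-tuple R), measurable N /\ lvol N = 0%E /\ A `<=` N.

Definition lmeasurable (R : realType) (n : nat) (A : set (n.-tuple R)) : Prop :=
  exists B : set (n.-tuple R), measurable B /\ lnull ((A `\` B) `|` (B `\` A)).

(* Lebesgue (outer) measure vol; it is the Lebesgue measure on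
   Lebesgue measurable sets. *)
Definition vol (R : realType) (n : nat) (A : set (n.-tuple R)) : \bar R :=
  ereal_inf [set lvol B | B in [set B : set (n.-tuple R) | measurable B /\ A `<=` B]].

Definition cube (R : realType) (n : nat) : set (n.-tuple R) :=
  [set x | forall i : 'I_n, 0 <= tnth x i <= 1].

(* rho is a probability density on [0,1]^n w.r.t. Lebesgue measure:
   nonnegative, and (Lebesgue) measurable with integral 1, expressed
   through a Borel representative g equal to rho almost everywhere. *)
Definition is_density (R : realType) (n : nat) (rho : n.-tuple R -> R) : Prop :=
  (forall x, cube x -> 0 <= rho x) /\
  exists g : n.-tuple R -> R,
    measurable_fun (@cube R n) g /\
    lnull [set x | cube x /\ rho x <> g x] /\
    (\int[@lvol R n]_(x in @cube R n) (g x)%:E)%E = 1%E.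

Definition bounded_on_cube (R : realType) (n : nat) (rho : n.-tuple R -> R) : Prop :=
  exists M : R, forall x, cube x -> `|rho x| <= M.

Definition supp (R : realType) (n : nat) (rho : n.-tuple R -> R) : set (n.-tuple R) :=
  [set x | cube x /\ 0 < rho x].

Definition pdist (R : realType) (n : nat) (p : R) (x y : n.-tuple R) : R :=
  if p == 0 then (#|[set i : 'I_n | tnth x i - tnth y i != 0]|)%:R
  else powR (\sum_(i < n) powR `|tnth x i - tnth y i| p) p^-1.

(* Main.v *)
Require Import Defs.
From HB Require Import structures.
From mathcomp Require Import all_boot all_order all_algebra.
From mathcomp Require Import all_classical all_reals all_analysis.
From mathcomp Require Import measurable_realfun ring lra zify.
Set Implicit Arguments. Unset Strict Implicit. Unset Printing Implicit Defensive.
Import Order.TTheory GRing.Theory Num.Theory.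
Import numFieldNormedType.Exports.
Local Open Scope classical_set_scope.
Local Open Scope ring_scope.

(* For [p > 0] the claim reduces to Euclidean distance, and then to Gaussian
   isoperimetry on the cube: if [B] has volume < 1/2, the points of the cube at
   distance at least [r] from the complement of [B] have volume < 1/2 exp(-pi r^2).
   Cut each side of the cube into intervals whose lengths are the binomial weights
   of [N] fair coins, so that the cube becomes an image of a discrete cube on which
   Bobkov's functional inequality holds (two-point inequality and tensorisation).
   The largest weight is at most [sqrt (2 / (pi N))] (Wallis), which makes this image
   asymptotically 1-Lipschitz for the density [phi x = exp(-pi x^2)].  Bobkov's
   inequality applied to [Phi (al * (g - s))], with [g] a smoothed distance to the
   complement of [B], becomes a differential inequality in [s] for the quantile of
   the mean, and [al] and [N] are then sent to infinity.
   For [p = 0], an induction on the dimension through sections bounds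
   [ln (vol S) / al + ln (vol D) / be] when [S] and [D] are far apart in Hamming
   distance; the one-dimensional step is Hoeffding's lemma. *)

(** * The Gaussian density exp(-pi x^2) *)

Section Gauss.
Context {R : realType}.
Implicit Types x y z a b : R.

(** The choice of [phi] comes from transport: its peak is 1, so its distribution function is a
    1-Lipschitz map carrying the Gaussian law to the uniform law on [0, 1]. Binomial lengths
    discretise this map, which spares Gaussian measures on R^n. In a coordinate of unit slope, a
    block of [N = 2m] coins contributes about [2 * pi * N / 4 * h ^+ 2] to Bobkov's gradient term,
    and Wallis' bound [h = 1 / sqrt (pi * m)] makes this exactly 1. The distance to a set has kinks,
    where the squared slopes along the axes can add up to more than 1; hence the smoothing.
    Smoothing and discretisation both lose a little although the volume hypothesis is non-strict:
    the loss is paid for by the slack in [f_c < 1/2], read on the quantile scale. So tolerances are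
    chosen from that slack, then a net and the smoothing parameters, and the number of coins last.
    In the Hamming case the same slack gives strictness. *)

Lemma derive_ge0_le (f df : R -> R) a b : a <= b ->
  (forall x, a <= x <= b -> is_derive x 1 f (df x)) ->
  (forall x, a <= x <= b -> 0 <= df x) -> f a <= f b.
Proof.
move=> ab fD df0.
have cf : {within `[a, b], continuous f}.
  apply: derivable_within_continuous => x; rewrite in_itv/= => xab.
  by have [] := fD x xab.
have [|c] := @MVT_segment R f df a b ab _ cf.
  by move=> x; rewrite in_itv/= => /andP[/ltW ax /ltW xb]; apply: fD; rewrite ax.
rewrite in_itv/= => cab e.
by rewrite -subr_ge0 e mulr_ge0 ?subr_ge0// df0.
Qed.

Lemma derive_gt0_lt (f df : R -> R) a b : a < b ->
  (forall x, a <= x <= b -> is_derive x 1 f (df x)) ->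
  (forall x, a <= x <= b -> 0 < df x) -> f a < f b.
Proof.
move=> ab fD df0.
have cf : {within `[a, b], continuous f}.
  apply: derivable_within_continuous => x; rewrite in_itv/= => xab.
  by have [] := fD x xab.
have [|c] := @MVT_segment R f df a b (ltW ab) _ cf.
  by move=> x; rewrite in_itv/= => /andP[/ltW ax /ltW xb]; apply: fD; rewrite ax.
rewrite in_itv/= => cab e.
by rewrite -subr_gt0 e mulr_gt0 ?subr_gt0// df0.
Qed.

Definition phi x : R := expR (- (pi * x ^+ 2)).
(** The standard deviation for which the centred normal density has peak 1. *)
Definition sdev : R := (Num.sqrt (pi *+ 2))^-1.

Lemma phi_pdf x : normal_pdf 0 sdev x = phi x.
Proof.
have s0 : sdev != 0.
  by rewrite invr_eq0 gt_eqF// sqrtr_gt0 mulrn_wgt0// pi_gt0.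
rewrite normal_pdfE//= /normal_peak /normal_fun.
have e : sdev ^+ 2 = (pi *+ 2)^-1.
  by rewrite exprVn sqr_sqrtr// mulrn_wge0// pi_ge0.
have p0 : pi != 0 :> R by rewrite gt_eqF// pi_gt0.
have e2 : (pi *+ 2)^-1 * pi *+ 2 = 1 :> R by rewrite -mulrnAr mulVf// mulrn_eq0.
rewrite e e2 subr0 -[Num.ExtraDef.sqrtr _]/(Num.sqrt _) sqrtr1 invr1 mul1r /phi.
congr expR; rewrite -mulr_natr -(mulr_natr _ 2).
by move: (pi : R) p0 => q q0; field.
Qed.

Notation mu := (@lebesgue_measure R).

Lemma integrable_phi : mu.-integrable setT (EFin \o phi).
Proof.
have := @integrable_normal_pdf R 0 sdev.
by rewrite (_ : (fun x => _) = EFin \o phi)//; apply/funext => x /=; rewrite phi_pdf.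
Qed.

Lemma continuous_phi : continuous phi.
Proof.
move=> x; apply: (@continuous_comp _ _ _ (fun x : R => - (pi * x ^+ 2)) expR).
  apply: cvgN; apply: cvgM; first exact: cvg_cst.
  exact: exprn_continuous.
exact: continuous_expR.
Qed.

Lemma phi_gt0 x : 0 < phi x. Proof. exact: expR_gt0. Qed.

Lemma phiN x : phi (- x) = phi x. Proof. by rewrite /phi sqrrN. Qed.

Definition Phi x : R := (\int[mu]_(t in `]-oo, x]) phi t)%R.

Lemma is_derive_Phi x : is_derive x 1 Phi (phi x).
Proof.
have [] := @continuous_FTC1 R phi -oo%O x (x + 1) _ _ _ _.
- by rewrite ltrDl.
- by apply: (integrableS measurableT) => //; exact: integrable_phi.
- by rewrite ltNyr.
- exact: continuous_phi.
move=> d e; apply: DeriveDef; first exact: d.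
by rewrite -derive1E; exact: e.
Qed.

Lemma is_derive_phi x : is_derive x 1 phi (- (2 * pi * x) * phi x).
Proof.
rewrite /phi; apply: is_derive_eq.
rewrite /GRing.scale/=; set u := expR _; move: u (pi : R) => u q; ring.
Qed.

Lemma Phi_lt x y : x < y -> Phi x < Phi y.
Proof.
move=> xy; apply: (@derive_gt0_lt _ phi) => // z _.
  exact: is_derive_Phi.
exact: phi_gt0.
Qed.

Lemma Phi_le x y : x <= y -> Phi x <= Phi y.
Proof. by rewrite le_eqVlt => /predU1P[->//|/Phi_lt/ltW]. Qed.

(** The limits of [Phi] at infinity are read off from the distribution function of the identity
    random variable under this normal law. *)
Let P : probability (measurableTypeR R) R := normal_prob (0:R) sdev.
Definition idR : measurableTypeR R -> R := idfun.
HB.instance Definition _ :=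
  @isMeasurableFun.Build _ _ (measurableTypeR R) R idR (@measurable_id _ _ setT).
Let X : {RV P >-> R} := idR.

Let cdfX x : cdf X x = (Phi x)%:E.
Proof.
rewrite /cdf /distribution /pushforward/= /P /normal_prob /Phi /Rintegral.
rewrite fineK; last first.
  apply: integrable_fin_num => //.
  by apply: (integrableS measurableT) => //; exact: integrable_phi.
by apply: eq_integral => t _; rewrite phi_pdf.
Qed.

Lemma cvg_Phiy : Phi x @[x --> +oo] --> (1:R).
Proof.
have := @cvg_cdfy1 _ _ _ _ X.
rewrite (_ : cdf X = EFin \o Phi); last by apply/funext => x; exact: cdfX.
by move=> /fine_cvgP[].
Qed.

Lemma cvg_PhiNy : Phi x @[x --> -oo] --> (0:R).
Proof.
have := @cvg_cdfNy0 _ _ _ _ X.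
rewrite (_ : cdf X = EFin \o Phi); last by apply/funext => x; exact: cdfX.
by move=> /fine_cvgP[].
Qed.


Lemma Phi_gt0 x : 0 < Phi x.
Proof.
apply: (@le_lt_trans _ _ (Phi (x - 1))); last by apply: Phi_lt; rewrite ltrBlDr ltrDl.
by rewrite /Phi Rintegral_ge0// => t _; exact/ltW/phi_gt0.
Qed.

Lemma Phi_sym x : Phi x + Phi (- x) = 1.
Proof.
(* [phi] is even, so [f] has zero derivative; its constant value is its limit at infinity. *)
pose f y := Phi y + Phi (- y).
have fD y : is_derive y 1 f 0.
  have d1 := is_derive_Phi y.
  have d2 : is_derive y 1 (fun y => Phi (- y)) (- phi y).
    have dN : is_derive y 1 (-%R : R -> R) (-1) by exact: is_deriveNid.
    have := @is_derive1_comp R Phi -%R y (phi (- y)) (-1) (is_derive_Phi (- y)) dN.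
    by rewrite phiN mulrN1.
  by have := is_deriveD d1 d2; rewrite subrr.
have fc y : f y = f x by apply: is_derive_0_is_cst.
have : f y @[y --> +oo] --> (1 + 0 : R).
  apply: cvgD; first exact: cvg_Phiy.
  by have /cvgNy_compNP := cvg_PhiNy.
under eq_fun do rewrite fc.
move=> /cvg_lim; rewrite lim_cst// addr0; exact.
Qed.

Lemma PhiN x : Phi (- x) = 1 - Phi x.
Proof. by rewrite -(Phi_sym x) addrC addKr. Qed.

Lemma Phi0 : Phi 0 = 1 / 2.
Proof. by have := Phi_sym 0; rewrite oppr0; lra. Qed.

Lemma Phi_lt1 x : Phi x < 1.
Proof. by have := Phi_sym x; have := Phi_gt0 (- x); lra. Qed.

Lemma Phi_surj a : 0 < a < 1 -> exists x, Phi x = a.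
Proof.
move=> /andP[a0 a1].
have [u ua] : exists u, Phi u < a.
  have H : \forall u \near -oo, Phi u < a by exact: (cvgr_lt _ cvg_PhiNy).
  exact: (filter_ex H).
have [v va] : exists v, a < Phi v.
  have H : \forall u \near +oo, a < Phi u by exact: (cvgr_gt _ cvg_Phiy).
  exact: (filter_ex H).
have uv : u <= v.
  by rewrite leNgt; apply/negP => /Phi_lt; rewrite ltNge (ltW (lt_trans ua va)).
have cP : {within `[u, v], continuous Phi}.
  apply: derivable_within_continuous => x _.
  by have [] := is_derive_Phi x.
have [|c _ <-] := @IVT R Phi u v a uv cP; last by exists c.
by rewrite ge_min le_max (ltW ua) (ltW va) orbT.
Qed.

(** The difference [f] of the two sides vanishes at 0, increases up to [1 / pi] and then decreases
    towards its limit 0, so it never becomes negative. *)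
Lemma Phi_tail x : 0 <= x -> Phi (- x) <= 1 / 2 * phi x.
Proof.
move=> x0.
pose f y := 1 / 2 * phi y + Phi y - 1.
have fD y : is_derive y 1 f (phi y * (1 - pi * y)).
  have d1 := is_derive_Phi y.
  have d2 := is_derive_phi y.
  rewrite /f; apply: is_derive_eq.
  rewrite /GRing.scale/=; move: (phi y) (pi : R) => u q; lra.
suff : 0 <= f x by rewrite /f PhiN; lra.
have f0 : f 0 = 0 by rewrite /f Phi0 /phi expr0n/= mulr0 oppr0 expR0; lra.
have p0 : 0 < pi :> R by exact: pi_gt0.
have [xp|xp] := leP x pi^-1.
  rewrite -f0; apply: (@derive_ge0_le f _ _ _ x0) => y /andP[y0 yx].
  rewrite mulr_ge0 ?(ltW (phi_gt0 _))// subr_ge0 mulrC -ler_pdivlMr// mul1r.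
  exact: le_trans yx xp.
rewrite leNgt; apply/negP => fx0.
have fmono y : x <= y -> f y <= f x.
  move=> xy; rewrite -lerN2.
  apply: (@derive_ge0_le (- f) (fun y => - (phi y * (1 - pi * y))) _ _ xy) => z /andP[xz zy].
  rewrite -mulrN mulr_ge0 ?(ltW (phi_gt0 _))// oppr_ge0 subr_le0 mulrC -ler_pdivrMr//.
  by rewrite mul1r (le_trans (ltW xp)).
have [y [xy]] : exists y, x <= y /\ 1 + f x < Phi y.
  have lt1 : 1 + f x < 1 by rewrite gtrDl.
  have H1 : \forall y \near +oo, 1 + f x < Phi y by exact: (cvgr_gt _ cvg_Phiy).
  have H2 := @nbhs_pinfty_ge R x (num_real x).
  have /filter_ex[y [? ?]] : \forall y \near +oo, x <= y /\ 1 + f x < Phi y.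
    by near=> y; split; near: y.
  by exists y.
have := fmono _ xy; have := phi_gt0 y; rewrite {1}/f; lra.
Unshelve. all: by end_near.
Qed.

End Gauss.

(** * Bobkov's two-point inequality *)

Section Bobkov2.
Context {R : realType}.
Implicit Types x y z a b c u : R.

Lemma Phi_inj : injective (@Phi R).
Proof.
move=> x y e; apply/eqP; rewrite eq_le.
by apply/andP; split; rewrite leNgt; apply/negP => /Phi_lt; rewrite e ltxx.
Qed.

Lemma Phi_ltP x y : (Phi x < Phi y) = (x < y).
Proof. by apply/idP/idP => [|/Phi_lt//]; rewrite !ltNge; apply: contra => /Phi_le. Qed.

Lemma Phi_leP x y : (Phi x <= Phi y) = (x <= y).
Proof. by rewrite !leNgt Phi_ltP. Qed.

(* quantile function of the measure with density [phi]; junk outside ]0, 1[ *)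
Definition Qf a : R := xget 0 [set x | Phi x = a].

Lemma QfK a : 0 < a < 1 -> Phi (Qf a) = a.
Proof. by move=> /Phi_surj[x e]; rewrite /Qf; case: xgetP => // /(_ x). Qed.

Lemma PhiK x : Qf (Phi x) = x.
Proof. by apply: Phi_inj; rewrite QfK// Phi_gt0 Phi_lt1. Qed.

Lemma Qf_le a b : 0 < a < 1 -> 0 < b < 1 -> (Qf a <= Qf b) = (a <= b).
Proof. by move=> a01 b01; rewrite -Phi_leP !QfK. Qed.

Lemma QfN a : 0 < a < 1 -> Qf (1 - a) = - Qf a.
Proof.
move=> a01; apply: Phi_inj; rewrite PhiN !QfK//.
by move: a01 => /andP[? ?]; rewrite subr_gt0 gtrBl; apply/andP.
Qed.

Lemma is_derive_Qf a : 0 < a < 1 -> is_derive a 1 Qf (phi (Qf a))^-1.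
Proof.
move=> a01; rewrite -{1}(QfK a01).
apply: (@is_derive_inverse _ (@Phi R)).
- by near=> x; exact: PhiK.
- near=> x; apply/differentiable_continuous/derivable1_diffP.
  by have [] := is_derive_Phi x.
- exact: is_derive_Phi.
- by rewrite gt_eqF// phi_gt0.
Unshelve. all: by end_near. Qed.

(** The Gaussian isoperimetric profile: the density at the endpoint of the half-line of mass [a]. *)
Definition Jf a : R := phi (Qf a).

Lemma Jf_gt0 a : 0 < Jf a. Proof. exact: phi_gt0. Qed.

Lemma JfN a : 0 < a < 1 -> Jf (1 - a) = Jf a.
Proof. by move=> a01; rewrite /Jf QfN// phiN. Qed.

Lemma is_derive_Jf a : 0 < a < 1 -> is_derive a 1 Jf (- (2 * pi * Qf a)).
Proof.
move=> a01.
have := @is_derive1_comp R phi Qf a _ _ (is_derive_phi (Qf a)) (is_derive_Qf a01).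
by rewrite mulfK// gt_eqF// phi_gt0.
Qed.

Lemma is_derive_Qf_sqr a : 0 < a < 1 ->
  is_derive a 1 (fun a => Qf a ^+ 2) (2 * (Qf a / Jf a)).
Proof.
move=> a01; have d1 := is_derive_Qf a01.
apply: is_derive_eq; rewrite /GRing.scale/= -/(Jf a).
move: (_^-1) => u; ring.
Qed.

Lemma is_derive_Jf_sqr a : 0 < a < 1 ->
  is_derive a 1 (fun a => Jf a ^+ 2) (- (4 * pi * (Qf a * Jf a))).
Proof.
move=> a01; have d1 := is_derive_Jf a01.
apply: is_derive_eq; rewrite /GRing.scale/=.
move: (pi : R) => q; ring.
Qed.

Lemma is_derive_QJ a : 0 < a < 1 ->
  is_derive a 1 (fun a => Qf a * Jf a) (1 - 2 * pi * Qf a ^+ 2).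
Proof.
move=> a01; have d1 := is_derive_Jf a01; have d2 := is_derive_Qf a01.
apply: is_derive_eq; rewrite /GRing.scale/= -/(Jf a).
rewrite divff ?gt_eqF ?Jf_gt0//.
move: (pi : R) => q; ring.
Qed.

Lemma is_derive_shift (f : R -> R) c u d :
  is_derive (c + u) 1 f d -> is_derive u 1 (fun u => f (c + u)) d.
Proof.
move=> fD.
have sD : is_derive u 1 (fun u => c + u) 1.
  by apply: is_derive_eq; rewrite add0r mulr1.
by have := @is_derive1_comp R f _ u _ _ fD sD; rewrite mulr1.
Qed.

Lemma is_derive_flip (f : R -> R) c u d :
  is_derive (c - u) 1 f d -> is_derive u 1 (fun u => f (c - u)) (- d).
Proof.
move=> fD.
have sD : is_derive u 1 (fun u => c - u) (-1).
  by apply: is_derive_eq; rewrite add0r mul1r.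
by have := @is_derive1_comp R f _ u _ _ fD sD; rewrite mulrN1.
Qed.

(** At [y = Qf a] this quotient is half the derivative of [Qf a ^+ 2], so its monotonicity is the
    convexity of the squared quantile. *)
Lemma ler_divphi y z : y <= z -> y / phi y <= z / phi z.
Proof.
move=> yz; apply: (@derive_ge0_le R (fun y => y / phi y) (fun x => (1 + 2 * pi * x ^+ 2) / phi x) _ _ yz) => [x _|x _].
  have d1 := is_derive_phi x.
  have d2 : is_derive x 1 (fun x => (phi x)^-1) (- (phi x) ^- 2 *: (- (2 * pi * x) * phi x)).
    by apply: is_deriveV; rewrite gt_eqF// phi_gt0.
  apply: is_derive_eq; rewrite /GRing.scale/=.
  have := phi_gt0 x; move: (phi x) (pi : R) => p q p0; field.
  by rewrite gt_eqF.
rewrite divr_ge0 ?(ltW (phi_gt0 _))// addr_ge0// mulr_ge0 ?sqr_ge0//.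
by rewrite mulr_ge0// pi_ge0.
Qed.

(** With [S = (A + B) ^+ 2] and [K = J ^+ 2], the last hypothesis reads
    [(4 * K - S) * (S - 2 * j) <= 0], whereas [A + B < 2 * J] would make both factors positive. *)
Lemma two_sqrt_algebra (A B J j : R) : 0 <= A -> 0 <= B -> 0 <= J ->
  A ^+ 2 + B ^+ 2 = 2 * J ^+ 2 + j ->
  (A ^+ 2 - B ^+ 2) ^+ 2 <= 8 * J ^+ 2 * j ->
  J <= 1 / 2 * A + 1 / 2 * B.
Proof.
move=> A0 B0 J0 e1 e2.
suff : 2 * J <= A + B by lra.
rewrite leNgt; apply/negP => lt.
have AB0 : 0 <= A * B by exact: mulr_ge0.
have s2 : (A + B) ^+ 2 < 4 * J ^+ 2.
  rewrite (_ : 4 * _ = (2 * J) ^+ 2); last by ring.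
  by rewrite ltr_pXn2r// nnegrE; lra.
have s3 : (A ^+ 2 - B ^+ 2) ^+ 2 = (A + B) ^+ 2 * (4 * J ^+ 2 + 2 * j - (A + B) ^+ 2).
  have -> : 4 * J ^+ 2 + 2 * j = 2 * (A ^+ 2 + B ^+ 2) by rewrite e1; ring.
  ring.
rewrite s3 in e2.
have s4 : 2 * J ^+ 2 + j <= (A + B) ^+ 2.
  by rewrite -e1 sqrrD; lra.
move: s2 s4 e2; set S := (A + B) ^+ 2; set K := J ^+ 2 => s2 s4 e2.
have : 0 < (4 * K - S) * (S - 2 * j).
  by apply: mulr_gt0; lra.
nra.
Qed.

(** Let [j x] be the excess of the sum of the two radicands over [2 * Jf c ^+ 2]. It is at least
    [8 * pi ^+ 2 * Qf c ^+ 2 * x ^+ 2] ([L2]), and the difference of the radicands lies between 0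
    and [8 * pi * |Qf c| * Jf c * x] ([L4], [L5]). These two bounds fit the hypothesis of
    [two_sqrt_algebra] exactly. *)
Lemma bobkov_aux c x : 0 <= x -> c <= 1 / 2 -> 0 < c - x ->
  Jf c <= 1 / 2 * Num.sqrt (Jf (c + x) ^+ 2 + 2 * pi * x ^+ 2) +
          1 / 2 * Num.sqrt (Jf (c - x) ^+ 2 + 2 * pi * x ^+ 2).
Proof.
move=> x0 c2 cx.
have p0 : 0 < pi :> R := pi_gt0 _.
have inp u : 0 <= u <= x -> 0 < c + u < 1 by lra.
have inm u : 0 <= u <= x -> 0 < c - u < 1 by lra.
have inc : 0 < c < 1 by lra.
have z0 : Qf c <= 0.
  by rewrite -Phi_leP QfK// Phi0.
have L0 u : 0 <= u <= x -> 2 * Qf c ^+ 2 <= Qf (c + u) ^+ 2 + Qf (c - u) ^+ 2.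
  move=> /andP[u0 ux].
  pose F v := Qf (c + v) ^+ 2 + Qf (c - v) ^+ 2.
  have -> : 2 * Qf c ^+ 2 = F 0 by rewrite /F addr0 subr0; ring.
  apply: (derive_ge0_le (df := fun v => 2 * (Qf (c + v) / Jf (c + v)) +
    - (2 * (Qf (c - v) / Jf (c - v)))) u0) => v /andP[v0 vu].
    have vx : 0 <= v <= x by rewrite v0 (le_trans vu).
    apply: is_deriveD.
      exact: (is_derive_shift (is_derive_Qf_sqr (inp _ vx))).
    exact: (is_derive_flip (is_derive_Qf_sqr (inm _ vx))).
  have vx : 0 <= v <= x by rewrite v0 (le_trans vu).
  rewrite subr_ge0 ler_pM2l// ler_divphi// Qf_le ?(inp _ vx) ?(inm _ vx)//; lra.
(* This is the derivative of [j u - 8 * pi ^+ 2 * Qf c ^+ 2 * u ^+ 2], the function of [L2]; its own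
   derivative is nonnegative by the midpoint convexity [L0]. *)
have L1 u : 0 <= u <= x ->
  0 <= - (4 * pi) * (Qf (c + u) * Jf (c + u) - Qf (c - u) * Jf (c - u))
       + (8 * pi - 16 * pi ^+ 2 * Qf c ^+ 2) * u.
  move=> /andP[u0 ux].
  pose F v := - (4 * pi) * (Qf (c + v) * Jf (c + v) - Qf (c - v) * Jf (c - v))
       + (8 * pi - 16 * pi ^+ 2 * Qf c ^+ 2) * v.
  have <- : F 0 = 0 by rewrite /F addr0 subr0 subrr !mulr0 addr0.
  apply: (@derive_ge0_le R F (fun v => 8 * pi ^+ 2 *
    (Qf (c + v) ^+ 2 + Qf (c - v) ^+ 2 - 2 * Qf c ^+ 2)) _ _ u0) => v /andP[v0 vu].
    have vx : 0 <= v <= x by rewrite v0 (le_trans vu).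
    have d1 := is_derive_shift (is_derive_QJ (inp _ vx)).
    have d2 := is_derive_flip (is_derive_QJ (inm _ vx)).
    rewrite /F; apply: is_derive_eq; rewrite /GRing.scale/=.
    move: (pi : R) => q; ring.
  have vx : 0 <= v <= x by rewrite v0 (le_trans vu).
  by rewrite mulr_ge0 ?subr_ge0 ?L0// mulr_ge0// sqr_ge0.
pose j v := Jf (c + v) ^+ 2 + Jf (c - v) ^+ 2 - 2 * Jf c ^+ 2 + 4 * pi * v ^+ 2.
have L2 : 8 * pi ^+ 2 * Qf c ^+ 2 * x ^+ 2 <= j x.
  pose F v := j v - 8 * pi ^+ 2 * Qf c ^+ 2 * v ^+ 2.
  rewrite -subr_ge0 -/(F x).
  have <- : F 0 = 0 by rewrite /F /j addr0 subr0; ring.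
  have FD v : 0 <= v <= x -> is_derive v 1 F
      (- (4 * pi) * (Qf (c + v) * Jf (c + v) - Qf (c - v) * Jf (c - v))
       + (8 * pi - 16 * pi ^+ 2 * Qf c ^+ 2) * v).
    move=> vx.
    have d1 := is_derive_shift (is_derive_Jf_sqr (inp _ vx)).
    have d2 := is_derive_flip (is_derive_Jf_sqr (inm _ vx)).
    rewrite /F /j; apply: is_derive_eq; rewrite /GRing.scale/=.
    move: (pi : R) => q; ring.
  exact: (derive_ge0_le x0 FD L1).
have L3 u : 0 <= u <= x ->
  0 <= 4 * pi * (Qf (c + u) * Jf (c + u) + Qf (c - u) * Jf (c - u)) - 8 * pi * (Qf c * Jf c).
  move=> /andP[u0 ux].
  pose F v := 4 * pi * (Qf (c + v) * Jf (c + v) + Qf (c - v) * Jf (c - v)) - 8 * pi * (Qf c * Jf c).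
  have <- : F 0 = 0 by rewrite /F addr0 subr0; ring.
  apply: (@derive_ge0_le R F (fun v => 8 * pi ^+ 2 *
    (Qf (c - v) ^+ 2 - Qf (c + v) ^+ 2)) _ _ u0) => v /andP[v0 vu].
    have vx : 0 <= v <= x by rewrite v0 (le_trans vu).
    have d1 := is_derive_shift (is_derive_QJ (inp _ vx)).
    have d2 := is_derive_flip (is_derive_QJ (inm _ vx)).
    rewrite /F; apply: is_derive_eq; rewrite /GRing.scale/=.
    move: (pi : R) => q; ring.
  have vx : 0 <= v <= x by rewrite v0 (le_trans vu).
  (* As [c <= 1 / 2], the point [c - v] is at least as far from 1/2 as [c + v]; [zpm] and [zmp]
     together say [|Qf (c + v)| <= - Qf (c - v)]. *)
  have zpm : Qf (c + v) <= - Qf (c - v).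
    by rewrite -QfN ?(inm _ vx)// Qf_le ?(inp _ vx)//; have := inm _ vx; lra.
  have zmp : Qf (c - v) <= Qf (c + v) by rewrite Qf_le ?(inm _ vx) ?(inp _ vx)//; lra.
  rewrite mulr_ge0//; first by rewrite mulr_ge0// sqr_ge0.
  rewrite subr_sqr -mulrNN mulr_ge0//; lra.
have L4 : Jf (c + x) ^+ 2 - Jf (c - x) ^+ 2 <= - (8 * pi * (Qf c * Jf c)) * x.
  pose F v := - (8 * pi * (Qf c * Jf c)) * v - (Jf (c + v) ^+ 2 - Jf (c - v) ^+ 2).
  rewrite -subr_ge0 -/(F x).
  have <- : F 0 = 0 by rewrite /F addr0 subr0; ring.
  have FD v : 0 <= v <= x -> is_derive v 1 F
      (4 * pi * (Qf (c + v) * Jf (c + v) + Qf (c - v) * Jf (c - v)) - 8 * pi * (Qf c * Jf c)).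
    move=> vx.
    have d1 := is_derive_shift (is_derive_Jf_sqr (inp _ vx)).
    have d2 := is_derive_flip (is_derive_Jf_sqr (inm _ vx)).
    rewrite /F; apply: is_derive_eq; rewrite /GRing.scale/=.
    move: (pi : R) => q; ring.
  exact: (derive_ge0_le x0 FD L3).
have L5 : 0 <= Jf (c + x) ^+ 2 - Jf (c - x) ^+ 2.
  have xx : 0 <= x <= x by rewrite x0 lexx.
  have zpm : Qf (c + x) <= - Qf (c - x).
    by rewrite -QfN ?(inm _ xx)// Qf_le ?(inp _ xx)//; have := inm _ xx; lra.
  have zmp : Qf (c - x) <= Qf (c + x) by rewrite Qf_le ?(inm _ xx) ?(inp _ xx)//; lra.
  rewrite subr_ge0 ler_pXn2r ?nnegrE ?(ltW (Jf_gt0 _))//.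
  rewrite /Jf /phi ler_expR lerN2 ler_pM2l// -subr_ge0.
  rewrite subr_sqr -mulrNN mulr_ge0//; lra.
have nn a : 0 <= Jf a ^+ 2 + 2 * pi * x ^+ 2.
  by rewrite addr_ge0 ?sqr_ge0// mulr_ge0 ?sqr_ge0// mulr_ge0// ltW.
apply: (@two_sqrt_algebra _ _ _ (j x)); rewrite ?sqrtr_ge0 ?(ltW (Jf_gt0 _))//.
  rewrite !sqr_sqrtr// /j; move: (pi : R) => q; ring.
rewrite !sqr_sqrtr//.
apply: (@le_trans _ _ ((- (8 * pi * (Qf c * Jf c)) * x) ^+ 2)).
  rewrite (_ : _ - _ = Jf (c + x) ^+ 2 - Jf (c - x) ^+ 2); last by ring.
  by rewrite ler_pXn2r// nnegrE (le_trans L5).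
have -> : (- (8 * pi * (Qf c * Jf c)) * x) ^+ 2 = 8 * Jf c ^+ 2 * (8 * pi ^+ 2 * Qf c ^+ 2 * x ^+ 2).
  move: (pi : R) => q; ring.
by rewrite ler_wpM2l// mulr_ge0// sqr_ge0.
Qed.

(* Bobkov's two-point inequality, normalised so that [Jf * Jf'' = - 2 pi] *)
Lemma bobkov2 a b : 0 < a < 1 -> 0 < b < 1 ->
  Jf ((a + b) / 2) <=
    1 / 2 * Num.sqrt (Jf a ^+ 2 + 2 * pi * ((a - b) / 2) ^+ 2) +
    1 / 2 * Num.sqrt (Jf b ^+ 2 + 2 * pi * ((a - b) / 2) ^+ 2).
Proof.
wlog ab : a b / a <= b => [h a01 b01|].
  have [/h|/ltW/h] := leP a b; first by apply.
  move=> hh; have := hh b01 a01.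
  by rewrite (addrC b a) -(opprB a b) mulNr sqrrN [leRHS]addrC.
move=> a01 b01.
(* The reflection [a -> 1 - a] leaves [Jf] unchanged, so the midpoint may be assumed at most 1/2, as
   [bobkov_aux] requires. *)
wlog ab1 : a b a01 b01 ab / a + b <= 1 => [h|].
  have [ab1|/ltW h1] := leP (a + b) 1; first exact: h.
  have b01' : 0 < 1 - b < 1 by lra.
  have a01' : 0 < 1 - a < 1 by lra.
  have ab' : 1 - b <= 1 - a by lra.
  have s1 : 1 - b + (1 - a) <= 1 by lra.
  have := h _ _ b01' a01' ab' s1.
  rewrite !JfN//.
  have -> : (1 - b + (1 - a)) / 2 = 1 - (a + b) / 2 by lra.
  rewrite JfN; last by lra.
  have -> : 1 - b - (1 - a) = a - b by lra.
  by rewrite [leRHS]addrC.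
have x0 : 0 <= (b - a) / 2 by lra.
have c2 : (a + b) / 2 <= 1 / 2 by lra.
have cx : 0 < (a + b) / 2 - (b - a) / 2 by lra.
have := bobkov_aux x0 c2 cx.
have -> : (a + b) / 2 + (b - a) / 2 = b by lra.
have -> : (a + b) / 2 - (b - a) / 2 = a by lra.
by rewrite -(opprB a b) mulNr sqrrN [leRHS]addrC.
Qed.

End Bobkov2.

(** * Tensorisation and binomial projection *)

Section Coins.
Context {R : realType}.
Implicit Types (F U V : seq bool -> R) (s t : seq bool).

(** Expectation over [N] fair coins, recursive in the first coin so that tensorisation is a plain
    induction. *)
Fixpoint EC (N : nat) F : R :=
  if N is N'.+1 then 1 / 2 * EC N' (fun s => F (true :: s)) +
                     1 / 2 * EC N' (fun s => F (false :: s))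
  else F [::].

(* squared length of the discrete gradient of [F] at [s] *)
Fixpoint D2 F s : R :=
  if s is b :: t then ((F (true :: t) - F (false :: t)) / 2) ^+ 2 +
                      D2 (fun t => F (b :: t)) t
  else 0.

Lemma D2_ge0 F s : 0 <= D2 F s.
Proof. by elim: s F => //= b s IH F; rewrite addr_ge0// sqr_ge0. Qed.

Lemma EC_le N F U : (forall s, size s = N -> F s <= U s) -> EC N F <= EC N U.
Proof.
elim: N F U => [|N IH] F U h /=; first exact: h.
by rewrite lerD// ler_wpM2l//; try lra; apply: IH => s sN; apply: h; rewrite /= sN.
Qed.

Lemma eq_EC N F U : (forall s, size s = N -> F s = U s) -> EC N F = EC N U.
Proof. by move=> h; apply/le_anti/andP; split; apply: EC_le => s /h ->. Qed.

Lemma EC_D N F U : EC N (fun s => F s + U s) = EC N F + EC N U.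
Proof. by elim: N F U => //= N IH F U; rewrite !IH; lra. Qed.

Lemma EC_Z N c F : EC N (fun s => c * F s) = c * EC N F.
Proof. by elim: N F => //= N IH F; rewrite !IH; lra. Qed.

Lemma EC_cst N c : EC N (fun=> c) = c.
Proof. by elim: N => //= N ->; lra. Qed.

Lemma EC_itv01 N F : (forall s, 0 < F s < 1) -> 0 < EC N F < 1.
Proof.
elim: N F => [|N IH] F h /=; first exact: h.
have := IH (fun s => F (true :: s)) (fun s => h _).
have := IH (fun s => F (false :: s)) (fun s => h _).
lra.
Qed.

Lemma EC_cat N M F : EC (N + M) F = EC N (fun s => EC M (fun t => F (s ++ t))).
Proof. by elim: N F => //= N IH F; rewrite !IH. Qed.

(** Triangle inequality for the plane vector [(U, V)]: pair it pointwise with its mean [(A, B)] and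
    use Cauchy-Schwarz. *)
Lemma EC_minkowski N U V :
  Num.sqrt (EC N U ^+ 2 + EC N V ^+ 2) <= EC N (fun s => Num.sqrt (U s ^+ 2 + V s ^+ 2)).
Proof.
set A := EC N U; set B := EC N V; set n := Num.sqrt (A ^+ 2 + B ^+ 2).
have AB0 : 0 <= A ^+ 2 + B ^+ 2 by rewrite addr_ge0// sqr_ge0.
have n0 : 0 <= n by exact: sqrtr_ge0.
have n2 : n ^+ 2 = A ^+ 2 + B ^+ 2 by rewrite sqr_sqrtr.
have h : n * n <= n * EC N (fun s => Num.sqrt (U s ^+ 2 + V s ^+ 2)).
  rewrite -expr2 n2 -EC_Z.
  have -> : A ^+ 2 + B ^+ 2 = EC N (fun s => A * U s + B * V s).
    by rewrite EC_D !EC_Z -/A -/B !expr2.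
  apply: EC_le => s _; rewrite /n -sqrtrM//.
  apply: le_trans (ler_norm _) _; rewrite -sqrtr_sqr; apply: ler_wsqrtr.
  have := sqr_ge0 (A * V s - B * U s); nra.
move: n0; rewrite le_eqVlt => /predU1P[<-|n0]; last by rewrite ler_pM2l in h.
by rewrite -[leLHS](EC_cst N); apply: EC_le => s _; exact: sqrtr_ge0.
Qed.

(** Tensorisation: the two-point inequality handles the first coin, the induction hypothesis each
    half, and [EC_minkowski] moves the square root inside the expectation. *)
Lemma bobkov_cube N F : (forall s, 0 < F s < 1) ->
  Jf (EC N F) <= EC N (fun s => Num.sqrt (Jf (F s) ^+ 2 + 2 * pi * D2 F s)).
Proof.
have p0 : 0 <= 2 * pi :> R by rewrite mulr_ge0// pi_ge0.
elim: N F => [|N IH] F F01 /=.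
  by rewrite mulr0 addr0 sqrtr_sqr ler_norm.
set a := EC N _; set b := EC N (fun s => F (false :: s)).
have a01 : 0 < a < 1 by exact: EC_itv01.
have b01 : 0 < b < 1 by exact: EC_itv01.
have key (f : bool) : Num.sqrt (Jf (EC N (fun s => F (f :: s))) ^+ 2 + 2 * pi * ((a - b) / 2) ^+ 2)
  <= EC N (fun s => Num.sqrt (Jf (F (f :: s)) ^+ 2 +
       2 * pi * (((F (true :: s) - F (false :: s)) / 2) ^+ 2 + D2 (fun t => F (f :: t)) s))).
  (* [U] is the integrand of the induction hypothesis on the half [f]; [V] is the half difference
     across the first coin, scaled so that [V ^+ 2] is its gradient term. *)
  set U := fun s => Num.sqrt (Jf (F (f :: s)) ^+ 2 + 2 * pi * D2 (fun t => F (f :: t)) s).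
  set V := fun s => Num.sqrt (2 * pi) / 2 * (F (true :: s) + -1 * F (false :: s)).
  have U0 s : 0 <= Jf (F (f :: s)) ^+ 2 + 2 * pi * D2 (fun t => F (f :: t)) s.
    by rewrite addr_ge0 ?sqr_ge0// mulr_ge0// D2_ge0.
  apply: (@le_trans _ _ (Num.sqrt (EC N U ^+ 2 + EC N V ^+ 2))).
    apply: ler_wsqrtr; rewrite lerD//.
      have JU := IH (fun t => F (f :: t)) (fun s => F01 _).
      by rewrite ler_pXn2r ?nnegrE// ?(le_trans _ JU)// ltW// Jf_gt0.
    rewrite /V EC_Z EC_D EC_Z -/a -/b.
    rewrite (_ : (_ / 2 * (a + -1 * b)) ^+ 2 = Num.sqrt (2 * pi) ^+ 2 * ((a - b) / 2) ^+ 2).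
      by rewrite sqr_sqrtr.
    by move: (Num.sqrt _) => q; ring.
  apply: le_trans (EC_minkowski _ _ _) _.
  apply: EC_le => s _; apply: ler_wsqrtr.
  rewrite /U /V sqr_sqrtr//.
  rewrite (_ : (_ / 2 * _) ^+ 2 = Num.sqrt (2 * pi) ^+ 2 * ((F (true :: s) - F (false :: s)) / 2) ^+ 2).
    by rewrite sqr_sqrtr//; move: (Jf _) (pi : R) => u q; lra.
  by move: (Num.sqrt _) => q; ring.
have -> : 1 / 2 * a + 1 / 2 * b = (a + b) / 2 by lra.
apply: le_trans (bobkov2 a01 b01) _.
by rewrite lerD// ler_wpM2l ?key//; lra.
Qed.

Lemma eq_D2 F U s : (forall t, size t = size s -> F t = U t) -> D2 F s = D2 U s.
Proof.
elim: s F U => //= b s IH F U h; rewrite !h//=.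
by congr (_ + _); apply: IH => t ts; rewrite h//= ts.
Qed.

Lemma D2_cat F s t :
  D2 F (s ++ t) = D2 (fun s => F (s ++ t)) s + D2 (fun t => F (s ++ t)) t.
Proof. by elim: s F => [|b s IH] F /=; rewrite ?add0r// IH addrA. Qed.

(** Flipping one coin moves the count by one, up or down according to its face. Each coin
    contributes at most [L / 4], since [D2] uses half differences. *)
Lemma D2_count (f : nat -> R) s (L : R) : let k := count id s in
  ((0 < k)%N -> (f k - f k.-1) ^+ 2 <= L) ->
  ((k < size s)%N -> (f k.+1 - f k) ^+ 2 <= L) ->
  D2 (fun s => f (count id s)) s <= (size s)%:R / 4 * L.
Proof.
elim: s f => [|b s IH] f /=; first by rewrite !mul0r.
have e1 : (size s).+1%:R / 4 * L = L / 4 + (size s)%:R / 4 * L by rewrite -natr1; lra.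
case: b => /=; rewrite ?add1n ?add0n ltnS => h1 h2.
  have := IH (fun k => f k.+1) _ _.
  rewrite /= => IH'; rewrite e1.
    rewrite lerD//.
    have := h1 isT; rewrite /= => h; lra.
  apply: IH' => [k0|]; last exact: h2.
  by have := h1 isT; rewrite /= prednK.
have cs := count_size id s.
have := IH f h1 _.
rewrite /= => IH'; rewrite e1.
rewrite lerD//.
  have := h2 cs; rewrite /= => h; lra.
by apply: IH' => k0; apply: h2.
Qed.

(** Numbers of heads in [n] consecutive blocks of [N] coins: the map from the discrete cube to the
    indices of the cells of the real cube. *)
Fixpoint blk (N n : nat) s : seq nat :=
  if n is n'.+1 then count id (take N s) :: blk N n' (drop N s) else [::].

(** Index vectors are functions on [nat] of which only the first [n] values count, so that inserting
    and updating entries needs no bounds. *)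
Definition scons (c : nat) (k : nat -> nat) : nat -> nat :=
  fun i => if i is i'.+1 then k i' else c.

Definition upd T (k : nat -> T) (j : nat) (v : T) : nat -> T :=
  fun i => if i == j then v else k i.

Lemma nth_scons c (k : seq nat) : nth 0%N (c :: k) = scons c (nth 0%N k).
Proof. by apply/funext; case. Qed.

Lemma upd_scons0 c k v : upd (scons c k) 0 v = scons v k.
Proof. by apply/funext; case. Qed.

Lemma upd_sconsS c k j v : upd (scons c k) j.+1 v = scons c (upd k j v).
Proof. by apply/funext; case. Qed.

(** A coin of block [j] affects only the entry [k j], so [D2_count] applies block by block. *)
Lemma D2_blk N n (G : (nat -> nat) -> R) s (L : nat -> R) : size s = (n * N)%N ->
  let k := nth 0%N (blk N n s) in
  (forall j, (j < n)%N ->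
    ((0 < k j)%N -> (G k - G (upd k j (k j).-1)) ^+ 2 <= L j) /\
    ((k j < N)%N -> (G (upd k j (k j).+1) - G k) ^+ 2 <= L j)) ->
  D2 (fun s => G (nth 0%N (blk N n s))) s <= \sum_(j < n) N%:R / 4 * L j.
Proof.
elim: n s G L => [|n IH] s G L.
  by rewrite mul0n => /size0nil -> /= _; rewrite big_ord0.
rewrite mulSn => sN.
have [s1 [s2 [-> s1N s2N]]] : exists s1 s2, [/\ s = s1 ++ s2, size s1 = N & size s2 = (n * N)%N].
  exists (take N s), (drop N s); rewrite cat_take_drop; split=> //.
    by rewrite size_takel// sN leq_addr.
  by rewrite size_drop sN addKn.
have E t1 t2 : size t1 = N -> nth 0%N (blk N n.+1 (t1 ++ t2)) =
    scons (count id t1) (nth 0%N (blk N n t2)).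
  by move=> t1N; rewrite /= take_size_cat// drop_size_cat// nth_scons.
rewrite [X in let k := X in _]E//= => h.
rewrite D2_cat big_ord_recl lerD//.
  rewrite (@eq_D2 _ (fun t => G (scons (count id t) (nth 0%N (blk N n s2)))) s1); last first.
    by move=> t ts; rewrite E// ts.
  rewrite -[X in X%:R / 4 * _]s1N; apply: (@D2_count (fun c => G (scons c (nth 0%N (blk N n s2))))).
    by have [+ _] := h 0%N isT; rewrite upd_scons0.
  by have [_] := h 0%N isT; rewrite upd_scons0 s1N.
rewrite (@eq_D2 _ (fun t => G (scons (count id s1) (nth 0%N (blk N n t)))) s2); last first.
  by move=> t ts; rewrite E.
apply: (IH _ (fun k => G (scons (count id s1) k)) (fun j => L j.+1) s2N) => j jn.
by have := h j.+1 jn; rewrite !upd_sconsS.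
Qed.

Definition binw (N k : nat) : R := 'C(N, k)%:R / 2 ^+ N.

Fixpoint EB (N n : nat) (H : seq nat -> R) : R :=
  if n is n'.+1 then \sum_(k < N.+1) binw N k * EB N n' (fun l => H (nat_of_ord k :: l))
  else H [::].

(** The number of heads is binomial; the induction step is Pascal's rule. *)
Lemma EC_count N (f : nat -> R) :
  EC N (fun s => f (count id s)) = \sum_(k < N.+1) binw N k * f k.
Proof.
elim: N f => [|N IH] f /=.
  by rewrite big_ord1 /binw bin0 expr0 divr1 mul1r.
under eq_EC do rewrite add1n.
rewrite (IH (fun k => f k.+1)).
under [X in _ + 1 / 2 * X]eq_EC do rewrite add0n.
rewrite IH [RHS]big_ord_recl/= /binw bin0.
under [X in _ = _ + X]eq_bigr => i _.
  rewrite /bump/= add1n binS natrD mulrDl mulrDl.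
  over.
rewrite big_split/= [X in _ = _ + (X + _)]big_ord_recr/= bin_small// mul0r mul0r addr0.
rewrite [X in _ + 1 / 2 * X]big_ord_recl/= bin0 mulrDr !mulr_sumr exprS invfM.
have e : 1 / 2 * (1%:R / 2 ^+ N * f 0%N) = 1%:R * (2^-1 * (2 ^+ N)^-1) * f 0%N.
  by rewrite !mul1r mulrA.
rewrite e addrCA; congr (_ + _); rewrite addrC; congr (_ + _).
  by apply: eq_bigr => i _; rewrite /bump/= add1n; move: ((2 ^+ N)^-1) => q; lra.
by apply: eq_bigr => i _; move: ((2 ^+ N)^-1) => q; lra.
Qed.

Lemma EC_blk N n (H : seq nat -> R) : EC (n * N) (fun s => H (blk N n s)) = EB N n H.
Proof.
elim: n H => //= n IH H; rewrite mulSn EC_cat.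
rewrite -(EC_count N (fun k => EB N n (fun l => H (k :: l)))).
apply: eq_EC => s sN; rewrite -IH; apply: eq_EC => t tN.
by rewrite take_size_cat// drop_size_cat.
Qed.

End Coins.

(** * Wallis' bound for binomial weights *)

Section Wallis.
Context {R : realType}.
Implicit Types x y : R.

(* antiderivative of [cos ^+ n] vanishing at 0 *)
Fixpoint cosprim (n : nat) x : R :=
  match n with
  | 0 => x
  | 1 => sin x
  | (n'.+1 as n1).+1 => (cos x ^+ n1 * sin x + n1%:R * cosprim n' x) / n1.+1%:R
  end.

Lemma is_derive_cosprim n x : is_derive x 1 (cosprim n) (cos x ^+ n).
Proof.
suff [] : is_derive x 1 (cosprim n) (cos x ^+ n) /\
          is_derive x 1 (cosprim n.+1) (cos x ^+ n.+1) by [].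
elim: n => [|n [IH1 IH2]]; first by rewrite expr0 expr1; split; [exact: is_derive_id|exact: is_derive_sin].
split; first exact: IH2.
rewrite [cosprim n.+2](_ : _ = fun x => (cos x ^+ n.+1 * sin x + n.+1%:R * cosprim n x) / n.+2%:R)//.
move: (cosprim n) IH1 => P IH1 {IH2}.
have d1 : is_derive x 1 (fun x => cos x ^+ n.+1) (n.+1%:R * cos x ^+ n * - sin x).
  have -> : (fun x => cos x ^+ n.+1) = (cos : R -> R) ^+ n.+1.
    by rewrite exprfctE.
  exact: (is_deriveX n.+1 (is_derive_cos x)).
have d2 := is_deriveM d1 (is_derive_sin x).
have d3 := is_deriveZ n.+1%:R IH1.
have d4 := is_deriveZ (n.+2%:R^-1) (is_deriveD d2 d3).
rewrite (_ : (fun x => _) = n.+2%:R^-1 \*: ((fun x => cos x ^+ n.+1) * sin + n.+1%:R \*: P)); last first.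
  by apply/funext => y; rewrite !fctE /GRing.scale/= mulrC.
apply: is_derive_eq; rewrite /GRing.scale/=.
have n2 : n.+2%:R != 0 :> R by rewrite pnatr_eq0.
apply: (mulfI n2); rewrite mulVKf//.
have e : sin x ^+ 2 = 1 - cos x ^+ 2 by rewrite -(cos2Dsin2 x) addrC addKr.
have -> : n.+2%:R = 1 + n.+1%:R :> R by rewrite -natr1 addrC.
have -> : sin x * (n.+1%:R * cos x ^+ n * - sin x) = - (n.+1%:R * cos x ^+ n * sin x ^+ 2) by ring.
rewrite e !exprS; ring.
Qed.

Lemma cosprim_rec n : cosprim n.+2 (pi / 2) = n.+1%:R / n.+2%:R * cosprim n (pi / 2).
Proof. by rewrite /= cos_pihalf expr0n/= mul0r add0r mulrAC. Qed.

(** By the recurrence the left-hand side does not depend on [n]. *)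
Lemma cosprim_prod n : n.+1%:R * cosprim n (pi / 2) * cosprim n.+1 (pi / 2) = pi / 2.
Proof.
elim: n => [|n IH]; first by rewrite /= sin_pihalf mul1r mulr1.
rewrite cosprim_rec -[RHS]IH.
have n2 : n.+2%:R != 0 :> R by rewrite pnatr_eq0.
by move: (cosprim _ _) (cosprim _ _) => u v; field.
Qed.

Lemma cosprim_le n : cosprim n.+1 (pi / 2) <= cosprim n (pi / 2).
Proof.
have p2 : 0 <= pi / 2 :> R by rewrite divr_ge0// pi_ge0.
pose f x := cosprim n x - cosprim n.+1 x.
have e0 k : cosprim k 0 = 0.
  suff [] : cosprim k 0 = 0 /\ cosprim k.+1 0 = 0 by [].
  elim: k => [|k [IH1 IH2]]; first by rewrite /= sin0.
  by split=> //=; rewrite sin0 IH1 !mulr0 addr0 mul0r.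
rewrite -subr_ge0 -[leRHS]/(f (pi / 2)).
have <- : f 0 = 0 by rewrite /f !e0 subrr.
have fD x : 0 <= x <= pi / 2 -> is_derive x 1 f (cos x ^+ n - cos x ^+ n.+1).
  by move=> _; apply: is_deriveB; exact: is_derive_cosprim.
apply: (derive_ge0_le p2 fD) => x /andP[x0 x2].
have c0 : 0 <= cos x.
  apply: cos_ge0_pihalf; rewrite x2 andbT (le_trans _ x0)//.
  by rewrite oppr_le0.
by rewrite exprS subr_ge0 ler_piMl// ?exprn_ge0// cos_le1.
Qed.

(** Both sides satisfy the same recurrence in [m]. *)
Lemma central_binw m : cosprim m.*2 (pi / 2) = pi / 2 * binw m.*2 m.
Proof.
elim: m => [|m IH]; first by rewrite /binw bin0 expr0 divr1 mulr1.
rewrite doubleS cosprim_rec IH.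
have e : (m.+1 * 'C(m.*2.+2, m.+1) = 2 * m.*2.+1 * 'C(m.*2, m))%N.
  rewrite -mul_bin_diag.
  have e1 : (m.+1 * 'C(m.*2.+1, m.+1) = m.*2.+1 * 'C(m.*2, m))%N by rewrite -mul_bin_diag.
  have e2 : ('C(m.*2.+1, m.+1) = 'C(m.*2.+1, m))%N.
    rewrite -bin_sub; last by lia.
    by congr binomial; lia.
  by rewrite -e2; lia.
have eR : m.+1%:R * 'C(m.*2.+2, m.+1)%:R = 2 * m.*2.+1%:R * 'C(m.*2, m)%:R :> R.
  by rewrite -!natrM e.
have m1 : m.+1%:R != 0 :> R by rewrite pnatr_eq0.
rewrite /binw.
have -> : 'C(m.*2.+2, m.+1)%:R = 2 * m.*2.+1%:R * 'C(m.*2, m)%:R / m.+1%:R :> R.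
  by rewrite -eR mulrAC divff// mul1r.
have -> : m.*2.+2%:R = 2 * m.+1%:R :> R by rewrite -natrM mul2n doubleS.
rewrite !exprS.
have p2 : (2 ^+ m.*2 : R) != 0 by rewrite expf_neq0// pnatr_eq0.
move: (pi : R) (2 ^+ m.*2 : R) p2 (m.+1%:R : R) m1 (m.*2.+1%:R : R) => q P P0 b b0 a. move: ('C(m.*2, m)%:R) => C. by field; rewrite P0 b0.
Qed.

(** Writing [I_k] for the integral of [cos ^+ k] over [0, pi/2], monotonicity in [k] gives [I_(2m)
    ^+ 2 <= I_(2m-1) * I_(2m) = pi / (4m)], and [I_(2m)] is [pi / 2] times the central weight. *)
Lemma central_binw_le m : (0 < m)%N -> binw m.*2 m <= (Num.sqrt (pi * m%:R))^-1 :> R.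
Proof.
move=> m0; have p0 : 0 < pi :> R := pi_gt0 _.
have mR : 0 < m%:R :> R by rewrite ltr0n.
have b0 : 0 <= binw m.*2 m :> R by rewrite divr_ge0// exprn_ge0.
have h1 : cosprim m.*2 (pi / 2) ^+ 2 <= pi / (4 * m%:R).
  have e := cosprim_prod m.*2.-1; have l := cosprim_le m.*2.-1.
  rewrite prednK ?double_gt0// in e l.
  have m2 : m.*2%:R = 2 * m%:R :> R by rewrite -natrM mul2n.
  rewrite m2 in e.
  have -> : pi / (4 * m%:R) = cosprim m.*2.-1 (pi / 2) * cosprim m.*2 (pi / 2) :> R.
    have -> : pi / (4 * m%:R) = (pi / 2) / (2 * m%:R) :> R.
      by move: (pi : R) => q; field; rewrite gt_eqF.
    move: e; move: (cosprim m.*2.-1 _) (cosprim m.*2 _) => u v <-.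
    by field; rewrite gt_eqF.
  rewrite expr2 ler_wpM2r// central_binw mulr_ge0// divr_ge0// ltW//.
rewrite central_binw in h1.
rewrite -[leLHS]ger0_norm// -sqrtr_sqr -sqrtrV ?(ltW (mulr_gt0 p0 mR))//.
apply: ler_wsqrtr; rewrite -[leRHS]mul1r ler_pdivlMr ?mulr_gt0//.
have e1 : pi / (4 * m%:R) * (4 * m%:R / pi) = 1 :> R.
  by move: (pi : R) p0 => q q0; field; rewrite !gt_eqF.
rewrite -[leRHS]e1.
have -> : binw m.*2 m ^+ 2 * (pi * m%:R) = (pi / 2 * binw m.*2 m) ^+ 2 * (4 * m%:R / pi) :> R.
  by move: (pi : R) p0 (binw _ _) => q q0 b; field; rewrite gt_eqF.
by rewrite ler_wpM2r// divr_ge0 ?mulr_ge0// ltW.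
Qed.

Lemma bin_le_central m k : ('C(m.*2, k) <= 'C(m.*2, m))%N.
Proof.
have inc i : (i < m)%N -> ('C(m.*2, i) <= 'C(m.*2, i.+1))%N.
  move=> im; have := mul_bin_left m.*2 i => e.
  rewrite -(leq_pmul2l (ltn0Sn i)) e leq_mul2r; apply/orP; right; lia.
have low i : (i <= m)%N -> ('C(m.*2, i) <= 'C(m.*2, m))%N.
  move=> im; rewrite -(subKn im).
  elim: (m - i)%N => [|d IH]; first by rewrite subn0.
  have [dm|dm] := ltnP d m; last first.
    by have -> : (m - d.+1 = m - d)%N by lia.
  have e : ((m - d.+1).+1 = m - d)%N by lia.
  by apply: leq_trans IH; rewrite -e; apply: inc; lia.
have [km|km] := leqP k m; first exact: low.
have [k2|k2] := leqP k m.*2; last by rewrite bin_small.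
by rewrite -bin_sub// low//; lia.
Qed.

Lemma binw_le m k : (0 < m)%N -> binw m.*2 k <= (Num.sqrt (pi * m%:R))^-1 :> R.
Proof.
move=> m0; apply: le_trans (central_binw_le m0).
by rewrite ler_wpM2r ?invr_ge0 ?exprn_ge0// ler_nat bin_le_central.
Qed.

Lemma binw_ge0 N k : 0 <= binw N k :> R.
Proof. by rewrite divr_ge0// exprn_ge0. Qed.

Lemma binw_sum N : \sum_(k < N.+1) binw N k = 1 :> R.
Proof.
have := EC_count N (fun=> 1 : R); rewrite EC_cst => ->.
by apply: eq_bigr => i _; rewrite mulr1.
Qed.

End Wallis.

(** * The measure lvol *)

Section LvolMeasure.
Context {R : realType}.
Notation leb := (@lebesgue_measure R).

Definition consp n (z : R * n.-tuple R) : n.+1.-tuple R := cons_tuple z.1 z.2.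
Lemma measurable_consp n : measurable_fun setT (@consp n).
Proof.
have := @measurable_cons _ _ _ _ fst n snd (@measurable_fst _ _ R (n.-tuple R)) measurable_snd.
by congr measurable_fun; apply/funext => z; apply/val_inj.
Qed.

Lemma lvol_ge0 n (A : set (n.-tuple R)) : (0 <= lvol A)%E.
Proof.
elim: n A => [|n IH] A /=; first by case: ifP.
by apply: integral_ge0 => x _; exact: IH.
Qed.

Lemma lvol_set0 n : lvol (set0 : set (n.-tuple R)) = 0%E.
Proof.
elim: n => [|n IH] /=; first by case: ifPn => // /asboolP.
by apply: integral0_eq => x _; exact: IH.
Qed.

Lemma lvol_slab n (A : set (n.-tuple R)) (B : set R) : measurable B -> lvol A \is a fin_num ->
  lvol [set x : n.+1.-tuple R | B (thead x) /\ A [tuple of behead x]] = (leb B * lvol A)%E.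
Proof.
move=> mB /fineK eA; rewrite /= -eA muleC -integral_cst// [RHS]integral_mkcond.
apply: eq_integral => x _; rewrite patchE.
have hd (t : n.-tuple R) : [tuple of behead (cons_tuple x t)] = t by apply/val_inj.
have [Bx|Bx] := pselect (B x).
  rewrite mem_set//= eA; congr lvol; apply/seteqP; split=> t /=; rewrite hd; [by case|by []].
rewrite memNset//=.
rewrite (_ : [set _ | _] = set0) ?lvol_set0//.
by apply/seteqP; split=> t //= [].
Qed.

(** Both properties are carried through one induction: additivity in dimension [n.+1] comes from a
    product measure, whose second factor must already be sigma-finite. *)
Lemma lvol_measure_spec n : semi_sigma_additive (@lvol R n) /\
  sigma_finite setT (@lvol R n).
Proof.
elim: n => [|n [sa sf]].
  have e : @lvol R 0 = \d_([tuple] : 0.-tuple R).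
    apply/funext => A /=; rewrite diracE.
    case: ifPn => [/asboolP|/asboolPn] h; first by rewrite mem_set.
    by rewrite memNset.
  split; first by rewrite e; exact: measure_semi_sigma_additive.
  exists (fun=> setT); first by rewrite bigcup_const.
  by move=> _; split=> //; rewrite e diracT ltry.
pose m0 := isMeasure.Build _ _ _ (@lvol R n) (lvol_set0 n) (@lvol_ge0 n) sa.
pose mu0 : {measure set (n.-tuple R) -> \bar R} := HB.pack (@lvol R n) m0.
pose m1 := Measure_isSigmaFinite.Build _ _ _ mu0 sf.
pose mu : {sigma_finite_measure set (n.-tuple R) -> \bar R} := HB.pack (@lvol R n) m0 m1.
have e A : @lvol R n.+1 A = (leb \x mu)%E (@consp n @^-1` A).
  rewrite /= /product_measure1; apply: eq_integral => x _ /=.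
  by congr lvol; rewrite xsectionE.
split.
  have mc := @measurable_consp n.
  move=> F mF tF mUF; rewrite e preimage_bigcup.
  under eq_fun do under eq_bigr do rewrite e.
  apply: measure_semi_sigma_additive.
  - by move=> i; rewrite -[X in measurable X]setTI; exact: mc.
  - apply/trivIsetP => /= i j _ _ ij; rewrite -preimage_setI.
    by move/trivIsetP : tF => /(_ _ _ _ _ ij) ->//; rewrite preimage_set0.
  - by rewrite -preimage_bigcup -[X in measurable X]setTI; exact: mc.
(* Cubes of half-side [M] exhaust the space; [lvol_slab] gives their finite volume one dimension at
   a time. *)
exists (fun M => [set x | forall i, `|tnth x i| <= M%:R]).
  apply/seteqP; split=> // x _.
  exists (\max_i Num.bound `|tnth x i|)%N => // i /=.
  apply: le_trans (ltW (archi_boundP (normr_ge0 _))) _.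
  by rewrite ler_nat; apply: (@leq_bigmax _ (fun i => Num.bound `|tnth x i|)).
move=> M; split.
  have -> : [set x : n.+1.-tuple R | forall i, `|tnth x i| <= M%:R] =
      \bigcap_(i in [set: 'I_n.+1]) ((fun x => tnth x i) @^-1` `[- M%:R, M%:R]).
    by apply/seteqP; split=> x /= h i; [move=> _|]; have := h i; rewrite /= in_itv/= ler_norml; [|apply].
  apply: fin_bigcap_measurable => //= i _.
  by rewrite -[X in measurable X]setTI; apply: measurable_tnth.
elim: n.+1 => {sa sf m0 mu0 m1 mu e n} [|n IH].
  by rewrite /=; case: ifP => _; rewrite ?ltry.
have fn : lvol [set x : n.-tuple R | forall i, `|tnth x i| <= M%:R] \is a fin_num.
  by rewrite ge0_fin_numE// lvol_ge0.
have := lvol_slab (@measurable_itv R `[- M%:R, M%:R]) fn.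
rewrite (_ : [set _ | _ /\ _] = [set x | forall i, `|tnth x i| <= M%:R]) => [->|].
  rewrite lebesgue_measure_itv/= -(fineK fn).
  by case: ifP => _; rewrite ?mul0e// ?ltry.
apply/seteqP; split=> x; rewrite (tuple_eta x)/=.
  move=> [h1 h2] i; case: (unliftP ord0 i) => [j|] ->.
    have := h2 j; rewrite tnthS.
    by rewrite (_ : [tuple of _] = [tuple of behead x])//; apply/val_inj.
  by move: h1; rewrite tnth0 in_itv/= ler_norml.
move=> h; split; first by have := h ord0; rewrite tnth0 in_itv/= ler_norml.
move=> i; have := h (lift ord0 i); rewrite tnthS.
by rewrite (_ : [tuple of _] = [tuple of behead x])//; apply/val_inj.
Qed.

HB.instance Definition _ n := isMeasure.Build _ _ _ (@lvol R n)
  (lvol_set0 n) (@lvol_ge0 n) (lvol_measure_spec n).1.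

HB.instance Definition _ n := Measure_isSigmaFinite.Build _ _ _ (@lvol R n)
  (lvol_measure_spec n).2.

Lemma lvolS n (A : set (n.+1.-tuple R)) :
  lvol A = (\int[leb]_x lvol [set t : n.-tuple R | A (cons_tuple x t)])%E.
Proof. by []. Qed.

Lemma measurable_lvol_section n (A : set (n.+1.-tuple R)) : measurable A ->
  measurable_fun setT
    ((fun x => lvol [set t : n.-tuple R | A (cons_tuple x t)]) : R -> \bar R).
Proof.
move=> mA.
have mA' : measurable (@consp n @^-1` A).
  by rewrite -[X in measurable X]setTI; exact: measurable_consp.
have := @measurable_fun_xsection _ _ R _ R (@lvol R n) _ mA'.
by congr measurable_fun; apply/funext => x /=; rewrite xsectionE.
Qed.

Lemma measurable_section n (A : set (n.+1.-tuple R)) (x : R) : measurable A ->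
  measurable [set t : n.-tuple R | A (cons_tuple x t)].
Proof.
move=> mA.
have mA' : measurable (@consp n @^-1` A).
  by rewrite -[X in measurable X]setTI; exact: measurable_consp.
by have := measurable_xsection x mA'; rewrite xsectionE.
Qed.

Lemma measurable_cube n : measurable (@cube R n).
Proof.
have -> : @cube R n = \bigcap_(i in [set: 'I_n]) ((fun x => tnth x i) @^-1` `[0, 1]).
  by apply/seteqP; split=> x /= h i; [move=> _|]; have := h i; rewrite /= in_itv/=; [|apply].
apply: fin_bigcap_measurable => //= i _.
by rewrite -[X in measurable X]setTI; apply: measurable_tnth.
Qed.

Lemma cube_cons n x (t : n.-tuple R) :
  cube (cons_tuple x t) <-> 0 <= x <= 1 /\ cube t.
Proof.
split=> [h|[hx ht] i].
  split; first by have := h ord0; rewrite tnth0.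
  by move=> i; have := h (lift ord0 i); rewrite tnthS.
case: (unliftP ord0 i) => [j|] ->; first by rewrite tnthS.
by rewrite tnth0.
Qed.

End LvolMeasure.

(** * Binomial subdivision of the cube *)

Section Boxes.
Context {R : realType} (N : nat).
Notation leb := (@lebesgue_measure R).
Implicit Types (x : R) (k : nat).

(* [bincut k] is the binomial distribution function, so that the intervals
   [bincut k, bincut k.+1[ subdivide [0, 1] into pieces of binomial lengths *)
Definition bincut k : R := \sum_(i < k) binw N i.

(** [find] returns [N] when no cut up to [bincut N] exceeds [x], so the last cell also receives the
    endpoint 1; accordingly [cellset N] is closed on the right. *)
Definition cell x : nat := find (fun k => x < bincut k.+1) (iota 0 N).

Definition cellset k : set R :=
  [set` Interval (BLeft (bincut k)) (if (k < N)%N then BLeft (bincut k.+1) else BRight 1)].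

Lemma bincutS k : bincut k.+1 = bincut k + binw N k.
Proof. by rewrite /bincut big_ord_recr. Qed.

Lemma bincut_le i k : (i <= k)%N -> bincut i <= bincut k.
Proof.
elim: k => [|k IH]; first by rewrite leqn0 => /eqP ->.
rewrite leq_eqVlt => /predU1P[->//|]; rewrite ltnS => /IH h.
by rewrite bincutS (le_trans h)// lerDl binw_ge0.
Qed.

Lemma bincut0 : bincut 0 = 0. Proof. by rewrite /bincut big_ord0. Qed.

Lemma bincut1 : bincut N.+1 = 1. Proof. exact: binw_sum. Qed.

Lemma cell_le x : (cell x <= N)%N.
Proof. by rewrite -[X in (_ <= X)%N](size_iota 0) find_size. Qed.

Lemma cellsetE k x : (k <= N)%N -> cellset k x <-> 0 <= x <= 1 /\ cell x = k.
Proof.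
move=> kN; have sz : size (iota 0 N) = N by rewrite size_iota.
split.
  rewrite /cellset /= in_itv/= => /andP[kx h].
  have x0 : 0 <= x by rewrite -bincut0 (le_trans _ kx)// bincut_le.
  have [h1 h2] : x <= 1 /\ ((k < N)%N -> x < bincut k.+1).
    move: h; case: ifPn => h xk; last by split=> //; move/negP: h.
    split=> //; rewrite (le_trans (ltW xk))// -bincut1 bincut_le//.
  rewrite x0 h1; split=> //.
  have [kN'|Nk] := ltnP k N.
    apply/eqP; rewrite eqn_leq; apply/andP; split.
      rewrite leqNgt; apply/negP => /(before_find 0%N).
      by rewrite nth_iota// add0n h2.
    rewrite leqNgt; apply/negP => lt.
    have hs : has (fun i => x < bincut i.+1) (iota 0 N).
      by rewrite has_find sz (ltn_trans lt).
    have := nth_find 0%N hs; rewrite -/(cell x) nth_iota ?add0n; last exact: ltn_trans lt kN'.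
    by rewrite ltNge (le_trans _ kx)// bincut_le.
  have -> : k = N by apply/eqP; rewrite eqn_leq kN.
  apply/eqP; rewrite eqn_leq cell_le/= leqNgt; apply/negP => lt.
  have hs : has (fun i => x < bincut i.+1) (iota 0 N) by rewrite has_find sz.
  have := nth_find 0%N hs; rewrite -/(cell x) nth_iota ?add0n//.
  by rewrite ltNge (le_trans _ kx)// bincut_le// (leq_trans lt).
move=> [/andP[x0 x1] <-{k kN}]; rewrite /cellset /= in_itv/=.
apply/andP; split.
  case e : (cell x) => [|i]; first by rewrite bincut0.
  have lt : (i < cell x)%N by rewrite e.
  have := @before_find _ 0%N _ _ _ lt; rewrite nth_iota; last by rewrite (leq_trans lt)// cell_le.
  by rewrite add0n leNgt => ->.
case: ifPn => // lt.
have hs : has (fun i => x < bincut i.+1) (iota 0 N) by rewrite has_find sz.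
by have := nth_find 0%N hs; rewrite -/(cell x) nth_iota ?add0n.
Qed.

Lemma measurable_cellset k : measurable (cellset k).
Proof. exact: measurable_itv. Qed.

Lemma lebesgue_cellset k : (k <= N)%N -> leb (cellset k) = (binw N k)%:E.
Proof.
move=> kN; rewrite /cellset lebesgue_measure_itv/=.
have e : binw N k = bincut k.+1 - bincut k by rewrite bincutS addrC addKr.
have c1 : (k = N) -> bincut k.+1 = 1 by move=> ->; rewrite bincut1.
have [kN'|Nk] := ltnP k N; rewrite lte_fin -EFinB.
  rewrite -e; case: ifPn => //; rewrite -leNgt => h.
  by congr EFin; apply/le_anti; rewrite binw_ge0 /= e subr_le0.
have kNe : k = N by apply/eqP; rewrite eqn_leq kN.
rewrite -(c1 kNe) -e; case: ifPn => //; rewrite -leNgt => h.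
by congr EFin; apply/le_anti; rewrite binw_ge0 /= e subr_le0.
Qed.

Lemma cell_bounds x : 0 <= x <= 1 -> bincut (cell x) <= x <= bincut (cell x).+1.
Proof.
move=> x01; have := (@cellsetE (cell x) x (cell_le x)).2 (conj x01 erefl).
rewrite /cellset /= in_itv/= => /andP[->] /=; case: ifPn => [_ /ltW//|h x1].
rewrite (_ : cell x = N) ?bincut1//.
by apply/eqP; rewrite eqn_leq cell_le leqNgt.
Qed.

Lemma EB_ge0 n (H : seq nat -> R) : (forall l, 0 <= H l) -> 0 <= EB N n H.
Proof.
elim: n H => [|n IH] H H0 /=; first exact: H0.
by apply: sumr_ge0 => i _; rewrite mulr_ge0 ?binw_ge0// IH.
Qed.

Definition boxes n (P : pred (seq nat)) : set (n.-tuple R) :=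
  [set x | cube x /\ P [seq cell i | i <- x]].

Lemma boxes_cons n (P : pred (seq nat)) x (t : n.-tuple R) :
  boxes P (cons_tuple x t) <-> 0 <= x <= 1 /\ boxes (fun l => P (cell x :: l)) t.
Proof. by rewrite /boxes/= cube_cons; tauto. Qed.

Lemma measurable_boxes n (P : pred (seq nat)) : measurable (@boxes n P).
Proof.
elim: n P => [|n IH] P.
  have [h|h] := pselect (boxes P ([tuple] : 0.-tuple R)).
    rewrite (_ : boxes P = setT)//.
    by apply/seteqP; split=> // x _; rewrite (tuple0 x).
  rewrite (_ : boxes P = set0)//.
  by apply/seteqP; split=> // x; rewrite (tuple0 x).
have -> : @boxes n.+1 P = \bigcup_(k in `I_N.+1)
    ((@thead _ _) @^-1` cellset k `&`
     (fun x : n.+1.-tuple R => [tuple of behead x]) @^-1` boxes (fun l => P (k :: l))).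
  have hd y (t : n.-tuple R) : [tuple of behead (cons_tuple y t)] = t by apply/val_inj.
  have eta (x : n.+1.-tuple R) : exists y t, x = cons_tuple y t.
    by exists (thead x), [tuple of behead x]; rewrite {1}(tuple_eta x); apply/val_inj.
  apply/seteqP; split=> x; have [y [t ->]] := eta x.
    move=> /boxes_cons[x01 bx]; exists (cell y); first by rewrite /= ltnS cell_le.
    split; first by rewrite /= theadE; apply/cellsetE => //; exact: cell_le.
    by rewrite /= hd.
  move=> [k /= kN [/= h1 h2]]; rewrite theadE in h1.
  have [x01 e] := (@cellsetE k _ kN).1 h1.
  by apply/boxes_cons; split=> //; rewrite hd in h2; rewrite e.
apply: bigcup_measurable => k _; apply: measurableI.
  rewrite -[X in measurable X]setTI; apply: (@measurable_tnth _ _ _ ord0) => //.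
  exact: measurable_cellset.
by rewrite -[X in measurable X]setTI; apply: measurable_behead.
Qed.

(** The cell index of a uniform point of [0, 1] is binomial, so the volume of a union of boxes is a
    coin probability. *)
Lemma lvol_boxes n (P : pred (seq nat)) :
  lvol (@boxes n P) = (EB N n (fun l => (P l)%:R))%:E.
Proof.
elim: n P => [|n IH] P /=.
  case: ifPn => [/asboolP[_ /= ->]//|/asboolPn h].
  by case e : (P [::]) => //; exfalso; apply: h; split=> // -[].
pose c k := EB N n (fun l => (P (k :: l))%:R) : R.
have c0 k : 0 <= c k by apply: EB_ge0.
transitivity (\int[leb]_x (\sum_(k < N.+1) (c k)%:E * (\1_(cellset k) x)%:E))%E.
  apply: eq_integral => x _.
  have [x01|x01] := pselect (0 <= x <= 1).
    have -> : [set t : n.-tuple R | boxes P (cons_tuple x t)] = boxes (fun l => P (cell x :: l)).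
      by apply/seteqP; split=> t; [move=> /boxes_cons[]|move=> h; apply/boxes_cons].
    have cN := cell_le x; rewrite -ltnS in cN.
    rewrite IH (bigD1 (Ordinal cN))//= big1 ?adde0.
      rewrite indicE mem_set ?mule1//; apply/cellsetE => //.
    move=> k kx; rewrite indicE memNset ?mule0//.
    move=> /cellsetE[]; first by rewrite -ltnS.
    by move=> _ e; move/eqP: kx; apply; apply/val_inj.
  have -> : [set t : n.-tuple R | boxes P (cons_tuple x t)] = set0.
    by apply/seteqP; split=> t // /boxes_cons[].
  rewrite lvol_set0 big1// => k _; rewrite indicE memNset ?mule0//.
  by move=> /cellsetE[]//; rewrite -ltnS.
rewrite ge0_integral_sum//; last first.
- by move=> k x _; rewrite mule_ge0// lee_fin.
- move=> k; apply: measurable_funeM; apply/measurable_EFinP.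
  exact: measurable_indic (measurable_cellset _).
rewrite -sumEFin; apply: eq_bigr => k _.
rewrite ge0_integralZl_EFin//; last first.
  by apply/measurable_EFinP; exact: measurable_indic (measurable_cellset _).
rewrite integral_indic//; last exact: measurable_cellset.
rewrite setIT EFinM muleC; congr (_ * _)%E.
by apply: lebesgue_cellset; rewrite -ltnS.
Qed.

End Boxes.

(** * Smoothed distance to a finite set *)

Section Softmin.
Context {R : realType} (n : nat).
Implicit Types (x y : nat -> R).

Definition sqd x y : R := \sum_(i < n) (x i - y i) ^+ 2.

(** The term [d ^+ 2] rounds off the vertex of the cone: denominators in the expansion below stay at
    least [d]. *)
Definition sdist (d : R) x y : R := Num.sqrt (sqd x y + d ^+ 2).

Lemma sqd_ge0 x y : 0 <= sqd x y.
Proof. by apply: sumr_ge0 => i _; exact: sqr_ge0. Qed.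

Lemma sqd_coord x y (j : 'I_n) : (x j - y j) ^+ 2 <= sqd x y.
Proof. by rewrite /sqd (bigD1 j)//= lerDl; apply: sumr_ge0 => i _; exact: sqr_ge0. Qed.

Lemma sqd_upd x y (j : 'I_n) t :
  sqd (upd x j (x j + t)) y = sqd x y + (2 * t * (x j - y j) + t ^+ 2).
Proof.
rewrite /sqd (bigD1 j)//= [in RHS](bigD1 j)//= /upd eqxx.
rewrite (eq_bigr (fun i : 'I_n => (x i - y i) ^+ 2)).
  by set S := \sum_(_ < _ | _) _; ring.
by move=> i ij; rewrite -[_ == _ :> nat]/(i == j) (negPf ij).
Qed.

Section Sdist.
Variables (d : R) (d0 : 0 < d).

Lemma sdist_sqr x y : sdist d x y ^+ 2 = sqd x y + d ^+ 2.
Proof. by rewrite sqr_sqrtr// addr_ge0 ?sqd_ge0// sqr_ge0. Qed.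

Lemma sdist_ge x y : d <= sdist d x y.
Proof.
rewrite -[leLHS](ger0_norm (ltW d0)) -sqrtr_sqr; apply: ler_wsqrtr.
by rewrite lerDr sqd_ge0.
Qed.

Lemma sdist_gt0 x y : 0 < sdist d x y.
Proof. exact: lt_le_trans (sdist_ge x y). Qed.

Lemma sdist_coord x y (j : 'I_n) : `|x j - y j| <= sdist d x y.
Proof.
rewrite -sqrtr_sqr; apply: ler_wsqrtr; rewrite (le_trans (sqd_coord x y j))//.
by rewrite lerDl sqr_ge0.
Qed.

Lemma sdist_step x y (j : 'I_n) t :
  `|sdist d (upd x j (x j + t)) y - sdist d x y| <= `|t|.
Proof.
set x' := upd x j (x j + t); set q := sdist d x y; set q' := sdist d x' y.
have q0 : 0 < q by exact: sdist_gt0.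
have q'0 : 0 < q' by exact: sdist_gt0.
have e : (q' - q) * (q' + q) = t * ((x j - y j) + (x' j - y j)).
  rewrite -subr_sqr !sdist_sqr sqd_upd /x' /upd eqxx; ring.
rewrite -(@ler_pM2r _ (q' + q)) ?addr_gt0//.
rewrite -{1}(@ger0_norm _ (q' + q)) ?addr_ge0 ?(ltW q0) ?(ltW q'0)//.
rewrite -normrM e normrM ler_wpM2l// (le_trans (ler_normD _ _))// addrC.
by rewrite lerD// sdist_coord.
Qed.

(** First-order expansion in one coordinate. Multiplying by [q * (q' + q)] turns it into a
    polynomial identity, so no derivative of the square root is taken. *)
Lemma sdist_taylor x y (j : 'I_n) t :
  `|sdist d (upd x j (x j + t)) y - sdist d x y - t * ((x j - y j) / sdist d x y)|
    <= t ^+ 2 / d.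
Proof.
have st := sdist_step x y j t.
set x' := upd x j (x j + t); set q := sdist d x y; set q' := sdist d x' y.
have q0 : 0 < q by exact: sdist_gt0.
have q'0 : 0 < q' by exact: sdist_gt0.
have e : q' ^+ 2 - q ^+ 2 = 2 * t * (x j - y j) + t ^+ 2.
  rewrite !sdist_sqr sqd_upd; ring.
have zq := sdist_coord x y j.
have qd := sdist_ge x y; have q'd := sdist_ge x' y.
rewrite -/x' -/q -/q' in st zq qd q'd *.
set z := x j - y j in e zq *.
rewrite -(@ler_pM2r _ (q * (q' + q))); last by rewrite mulr_gt0// addr_gt0.
rewrite -{1}(@ger0_norm _ (q * (q' + q))); last by rewrite mulr_ge0// ?addr_ge0// ltW.
rewrite -normrM.
have -> : (q' - q - t * (z / q)) * (q * (q' + q)) = t * z * (q - q') + t ^+ 2 * q.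
  have -> : (q' - q - t * (z / q)) * (q * (q' + q)) =
     q * (q' ^+ 2 - q ^+ 2) - t * z * (q' + q) by field; rewrite gt_eqF.
  rewrite e; ring.
apply: (@le_trans _ _ (t ^+ 2 * q + t ^+ 2 * q)).
  apply: le_trans (ler_normD _ _) _; rewrite lerD//; last first.
    by rewrite normrM (ger0_norm (ltW q0)) ger0_norm ?sqr_ge0.
  rewrite !normrM (distrC q) -[t ^+ 2]ger0_norm ?sqr_ge0// normrX expr2.
  rewrite -mulrA [leRHS]mulrAC -[leRHS]mulrA ler_wpM2l// ler_pM//.
have -> : t ^+ 2 * q + t ^+ 2 * q = t ^+ 2 * (q + q) by ring.
rewrite -[leRHS]mulrA ler_wpM2l ?sqr_ge0// ler_pdivlMl//.
have -> : d * (q + q) = q * (d + d) by ring.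
by rewrite ler_wpM2l ?(ltW q0)// lerD.
Qed.

End Sdist.

Lemma expR_le_quad (u : R) : u <= 1 / 2 -> expR u <= 1 + u + 2 * u ^+ 2.
Proof.
move=> u2.
have h : 1 - u <= expR (- u) by exact: expR_ge1Dx.
have u1 : 0 < 1 - u by lra.
have -> : expR u = (expR (- u))^-1 by rewrite expRN invrK.
apply: (@le_trans _ _ (1 - u)^-1).
  by rewrite lef_pV2// posrE ?expR_gt0.
rewrite -[leLHS]mul1r ler_pdivrMr//.
have := sqr_ge0 u; nra.
Qed.

Section Weighted.
Variables (I : Type) (Y : seq I) (e : I -> R).
Hypothesis (e0 : forall k, 0 < e k) (Y0 : (0 < size Y)%N).
Let Z := \sum_(k <- Y) e k.

Lemma weight_gt0 : 0 < Z.
Proof.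
rewrite /Z; case: (Y) Y0 => // k s _; rewrite big_cons ltr_pwDl//.
by apply: sumr_ge0 => *; exact: ltW.
Qed.

Lemma weighted_sqr (a : I -> R) :
  ((\sum_(k <- Y) e k * a k) / Z) ^+ 2 <= (\sum_(k <- Y) e k * a k ^+ 2) / Z.
Proof.
have Zp := weight_gt0; set m := _ / Z.
have h : 0 <= \sum_(k <- Y) e k * (a k - m) ^+ 2.
  by apply: sumr_ge0 => k _; rewrite mulr_ge0 ?sqr_ge0// ltW.
have em : \sum_(k <- Y) e k * a k = m * Z by rewrite /m divfK ?gt_eqF.
have eh : \sum_(k <- Y) e k * (a k - m) ^+ 2 =
    \sum_(k <- Y) e k * a k ^+ 2 - m ^+ 2 * Z.
  rewrite (eq_bigr (fun k => e k * a k ^+ 2 + (- (2 * m) * (e k * a k) + m ^+ 2 * e k))).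
    rewrite big_split/= big_split/= -!mulr_sumr em -/Z; ring.
  by move=> k _; ring.
by rewrite ler_pdivlMr// -subr_ge0 -eh.
Qed.

(** The lower bound is Jensen's inequality. For the upper one the centred variable is at most
    [2 * tau], so the quadratic bound [2 * u ^+ 2] costs [2 * (2 * lam * tau) ^+ 2], whence the
    8. *)
Lemma weighted_exp (lam tau m : R) (D : I -> R) : 0 < lam -> 4 * lam * tau <= 1 ->
  (forall k, `|D k| <= tau) -> m = (\sum_(k <- Y) e k * D k) / Z ->
  expR (- (lam * m)) * Z <= \sum_(k <- Y) e k * expR (- (lam * D k))
  <= expR (- (lam * m) + 8 * lam ^+ 2 * tau ^+ 2) * Z.
Proof.
move=> lam0 lt Dt me; have Zp := weight_gt0.
have em : \sum_(k <- Y) e k * D k = m * Z by rewrite me divfK ?gt_eqF.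
have mt : `|m| <= tau.
  rewrite -(@ler_pM2r _ Z)// -{1}(ger0_norm (ltW Zp)) -normrM -em.
  apply: le_trans (ler_norm_sum _ _ _) _; rewrite /Z mulr_sumr; apply: ler_sum => k _.
  by rewrite normrM gtr0_norm// mulrC ler_wpM2r// ltW.
have esplit k : expR (- (lam * D k)) = expR (- (lam * m)) * expR (- (lam * (D k - m))).
  by rewrite -expRD; congr expR; ring.
have -> : \sum_(k <- Y) e k * expR (- (lam * D k)) =
    expR (- (lam * m)) * \sum_(k <- Y) e k * expR (- (lam * (D k - m))).
  by rewrite mulr_sumr; apply: eq_bigr => k _; rewrite esplit mulrCA.
rewrite expRD -mulrA !ler_pM2l ?expR_gt0//; apply/andP; split.
  have -> : Z = \sum_(k <- Y) e k * (1 + - (lam * (D k - m))).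
    rewrite (eq_bigr (fun k => e k + (- lam * (e k * D k) + lam * m * e k))).
      rewrite big_split/= big_split/= -!mulr_sumr em -/Z; ring.
    by move=> k _; ring.
  apply: ler_sum => k _; rewrite ler_pM2l//; exact: expR_ge1Dx.
have tau0 : 0 <= tau by exact: le_trans (normr_ge0 _) mt.
apply: (@le_trans _ _ (\sum_(k <- Y) e k * (1 + - (lam * (D k - m)) + 8 * lam ^+ 2 * tau ^+ 2))).
  apply: ler_sum => k _; rewrite ler_pM2l//.
  have b1 : `|D k - m| <= 2 * tau.
    apply: le_trans (ler_normB _ _) _; have := Dt k; lra.
  have b2 : - (lam * (D k - m)) <= 1 / 2.
    have : lam * `|D k - m| <= lam * (2 * tau) by rewrite ler_wpM2l// ltW.
    have : - (lam * (D k - m)) <= lam * `|D k - m|.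
      by rewrite -mulrN ler_wpM2l ?(ltW lam0)// ler_normr lexx orbT.
    lra.
  apply: le_trans (expR_le_quad b2) _; rewrite lerD2l.
  have : (D k - m) ^+ 2 <= (2 * tau) ^+ 2.
    by rewrite -real_normK ?num_real// ler_pXn2r// ?nnegrE ?mulr_ge0.
  have := sqr_ge0 lam; rewrite sqrrN exprMn; nra.
rewrite (eq_bigr (fun k => (1 + 8 * lam ^+ 2 * tau ^+ 2 + lam * m) * e k + - lam * (e k * D k))).
  rewrite big_split/= -!mulr_sumr em -/Z.
  have -> : (1 + 8 * lam ^+ 2 * tau ^+ 2 + lam * m) * Z + - lam * (m * Z) =
    (1 + 8 * lam ^+ 2 * tau ^+ 2) * Z by ring.
  by rewrite ler_pM2r//; exact: expR_ge1Dx.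
by move=> k _; ring.
Qed.

End Weighted.

Variables (lam d : R) (Y : seq (nat -> R)).
Hypothesis (lam0 : 0 < lam) (d0 : 0 < d) (Y0 : (0 < size Y)%N).

(** Log-sum-exp in place of the minimum of the distances to the points of [Y]. [softmin_le] and
    [softmin_ge] show that this costs at most [ln (size Y) / lam] on top of the rounding by [d]. *)
Definition softmin x : R :=
  - (ln (\sum_(y <- Y) expR (- (lam * sdist d x y))) / lam).

Lemma expR_softmin x : expR (- (lam * softmin x)) = \sum_(y <- Y) expR (- (lam * sdist d x y)).
Proof.
rewrite /softmin mulrN opprK mulrC divfK ?gt_eqF//.
by rewrite lnK// posrE; apply: weight_gt0 => // y; exact: expR_gt0.
Qed.

Lemma softmin_le x r : (exists2 i, (i < size Y)%N & sdist d x (nth (fun=> 0) Y i) <= r) ->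
  softmin x <= r.
Proof.
move=> [i iY h].
rewrite -(ler_pM2l lam0) -lerN2 -ler_expR expR_softmin.
apply: (@le_trans _ _ (expR (- (lam * sdist d x (nth (fun=> 0) Y i))))).
  by rewrite ler_expR lerN2 ler_pM2l.
rewrite (big_nth (fun=> 0)) big_mkord (bigD1 (Ordinal iY))//= lerDl.
by apply: sumr_ge0 => k _; exact: expR_ge0.
Qed.

Lemma softmin_ge x r : (forall i, (i < size Y)%N -> r <= sdist d x (nth (fun=> 0) Y i)) ->
  r - ln (size Y)%:R / lam <= softmin x.
Proof.
move=> h; rewrite -(ler_pM2l lam0) -lerN2 -ler_expR expR_softmin.
have sY : 0 < (size Y)%:R :> R by rewrite ltr0n.
have -> : expR (- (lam * (r - ln (size Y)%:R / lam))) = (size Y)%:R * expR (- (lam * r)).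
  rewrite -{2}(lnK (x := (size Y)%:R)) ?posrE// -expRD; congr expR.
  by move: (ln _) => u; field; rewrite gt_eqF.
rewrite (big_nth (fun=> 0)) big_mkord mulr_natl -[X in _ *+ X]card_ord -sumr_const.
apply: ler_sum => i _; by rewrite ler_expR lerN2 ler_pM2l// h.
Qed.

(** [v] is the gradient: an average, with exponential weights, of vectors of length at most 1, hence
    itself of length at most 1 by [weighted_sqr]. One vector [v] serves all coordinates, so the
    squared steps along the axes add up to about one squared step. *)
Lemma softmin_taylor x : exists v : nat -> R, \sum_(j < n) v j ^+ 2 <= 1 /\
  forall (j : 'I_n) t, 4 * lam * `|t| <= 1 ->
    `|softmin (upd x j (x j + t)) - softmin x| <= `|t| * `|v j| + (d^-1 + 8 * lam) * t ^+ 2.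
Proof.
pose e y := expR (- (lam * sdist d x y)).
have e0 y : 0 < e y by exact: expR_gt0.
pose Z := \sum_(y <- Y) e y.
have Zp : 0 < Z by exact: weight_gt0.
pose v (j : nat) := (\sum_(y <- Y) e y * ((x j - y j) / sdist d x y)) / Z.
exists v; split.
  apply: (@le_trans _ _ (\sum_(j < n) (\sum_(y <- Y) e y * ((x j - y j) / sdist d x y) ^+ 2) / Z)).
    by apply: ler_sum => j _; exact: weighted_sqr.
  rewrite -mulr_suml exchange_big/= ler_pdivrMr// mul1r; apply: ler_sum => y _.
  rewrite -mulr_sumr ger_pMr//.
  under eq_bigr do rewrite exprMn.
  rewrite -mulr_suml exprVn ler_pdivrMr ?exprn_gt0 ?sdist_gt0// mul1r sdist_sqr -/(sqd x y).
  by rewrite lerDl sqr_ge0.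
move=> j t lt.
pose D y := sdist d (upd x j (x j + t)) y - sdist d x y.
have Dt y : `|D y| <= `|t| by exact: sdist_step.
pose m := (\sum_(y <- Y) e y * D y) / \sum_(y <- Y) e y.
have /andP[h1 h2] := @weighted_exp _ Y e e0 Y0 lam `|t| m D lam0 lt Dt erefl.
have eS : \sum_(y <- Y) e y * expR (- (lam * D y)) = expR (- (lam * softmin (upd x j (x j + t)))).
  rewrite expR_softmin; apply: eq_bigr => y _; rewrite -expRD; congr expR; rewrite /D; ring.
rewrite eS -expR_softmin -!expRD !ler_expR real_normK ?num_real// in h1 h2.
(* [k1] and [k2] compare the increment with the weighted mean [m] of the distance increments; [k3]
   then compares [m] with its linear part. *)
have k1 : softmin (upd x j (x j + t)) - softmin x <= m.
  have gen (l p q w : R) : - (l * w) + - (l * p) <= - (l * q) -> l * (q - p) <= l * w by clear -lam0 d0 Y0; lra.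
  by rewrite -(ler_pM2l lam0); exact: gen h1.
have k2 : m - 8 * lam * t ^+ 2 <= softmin (upd x j (x j + t)) - softmin x.
  have gen (l p q w z : R) : - (l * q) <= - (l * w) + 8 * l ^+ 2 * z + - (l * p) ->
    l * (w - 8 * l * z) <= l * (q - p) by clear -lam0 d0 Y0; lra.
  by rewrite -(ler_pM2l lam0); exact: gen h2.
have k3 : `|m - t * v j| <= t ^+ 2 / d.
  have -> : m - t * v j = (\sum_(y <- Y) e y * (D y - t * ((x j - y j) / sdist d x y))) / Z.
    rewrite /m /v -/Z mulrA -mulrBl; congr (_ / _).
    rewrite mulr_sumr -sumrB; apply: eq_bigr => y _; ring.
  rewrite normrM normfV (gtr0_norm Zp) ler_pdivrMr//.
  apply: le_trans (ler_norm_sum _ _ _) _; rewrite /Z mulr_sumr; apply: ler_sum => y _.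
  by rewrite normrM gtr0_norm// mulrC ler_wpM2r ?(ltW (e0 y))//; exact: sdist_taylor.
have k4 : `|m| <= `|t| * `|v j| + t ^+ 2 / d.
  rewrite -normrM -[m](subrK (t * v j)) addrC (le_trans (ler_normD _ _))// lerD2l.
  done.
rewrite ler_norml.
have l8 : 0 <= 8 * lam * t ^+ 2 by rewrite mulr_ge0 ?sqr_ge0// mulr_ge0// ltW.
move: k4; rewrite ler_norml => /andP[k5 k6].
rewrite mulrDl (mulrC d^-1).
have gen (u w p q z : R) : u <= w -> w - z <= u -> - (p + q) <= w -> w <= p + q -> 0 <= z ->
  - (p + (q + z)) <= u <= p + (q + z) by clear -lam0 d0 Y0; lra.
exact: gen k1 k2 k5 k6 l8.
Qed.

End Softmin.

(** * Concentration *)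

Section Concentration.
Context {R : realType}.

(** The mean value theorem gives the density at an intermediate point; the exponential is the price
    of moving it to [a], where it matches [Jf (Phi a)] in Bobkov's inequality. *)
Lemma Phi_diff (K a b : R) : `|a| <= K -> `|b| <= K ->
  `|Phi b - Phi a| <= phi a * expR (2 * pi * K * `|b - a|) * `|b - a|.
Proof.
move=> aK bK; have p0 : 0 < pi :> R := pi_gt0 _.
have cP u v : {within `[u, v], continuous (@Phi R)}.
  apply: derivable_within_continuous => x _.
  by have [] := is_derive_Phi x.
have [c [h1 h2 ->]] : exists c, [/\ `|c| <= K, `|a - c| <= `|b - a| &
    `|Phi b - Phi a| = phi c * `|b - a|].
  move: aK bK; rewrite !ler_norml => aK bK.
  have [ab|ba] := leP a b.
    have [c] := MVT_segment ab (fun x _ => is_derive_Phi x) (cP a b).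
    rewrite in_itv/= => /andP[ac cb] ->; exists c; split.
    - by rewrite ler_norml; lra.
    - by rewrite distrC !ger0_norm; lra.
    - by rewrite normrM (gtr0_norm (phi_gt0 _)).
  have [c] := MVT_segment (ltW ba) (fun x _ => is_derive_Phi x) (cP b a).
  rewrite in_itv/= => /andP[ac cb] e; exists c; split.
  - by rewrite ler_norml; lra.
  - by rewrite (distrC b) !ger0_norm; lra.
  - by rewrite distrC e normrM (gtr0_norm (phi_gt0 _)) (distrC b).
rewrite ler_wpM2r// /phi -expRD ler_expR.
have ac : `|a + c| <= 2 * K by apply: le_trans (ler_normD _ _) _; lra.
have : `|a + c| * `|a - c| <= 2 * K * `|b - a| by rewrite ler_pM.
rewrite -normrM => h.
have : a ^+ 2 - c ^+ 2 <= 2 * K * `|b - a|.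
  by rewrite subr_sqr mulrC (le_trans (ler_norm _)).
rewrite -(ler_pM2l p0); lra.
Qed.

Lemma Phi_diff_sqr (K A B al h C v : R) : `|A| <= K -> `|B| <= K ->
  0 <= al -> 0 <= h -> 0 <= C -> 0 <= v <= 1 -> `|B - A| <= al * (h * v + C * h ^+ 2) ->
  (Phi B - Phi A) ^+ 2 <=
  (phi A * expR (2 * pi * K * (al * (h + C * h ^+ 2))) * (al * (h * v + C * h ^+ 2))) ^+ 2.
Proof.
move=> AK BK al0 h0 C0 /andP[v0 v1] BA.
have K0 : 0 <= K := le_trans (normr_ge0 _) AK.
have Ch : 0 <= C * h ^+ 2 by rewrite mulr_ge0 ?sqr_ge0.
have p0 : 0 <= 2 * pi * K by rewrite mulr_ge0// mulr_ge0// pi_ge0.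
have pE u : 0 <= phi A * expR u by rewrite mulr_ge0 ?expR_ge0// ltW// phi_gt0.
rewrite -[leLHS]real_normK ?num_real// ler_pXn2r ?nnegrE//; last first.
  by rewrite mulr_ge0// mulr_ge0// addr_ge0// mulr_ge0.
apply: le_trans (Phi_diff AK BK) _; rewrite ler_pM//.
rewrite ler_wpM2l ?(ltW (phi_gt0 _))// ler_expR ler_wpM2l//.
by apply: le_trans BA _; rewrite ler_wpM2l// lerD2r ler_piMr.
Qed.

Lemma is_derive_EC M (F F' : seq bool -> R -> R) (s : R) :
  (forall b, is_derive s (1 : R) (F b) (F' b s)) ->
  is_derive s (1 : R) (fun s => EC M (fun b => F b s)) (EC M (fun b => F' b s)).
Proof.
elim: M F F' => [|M IH] F F' h /=; first exact: h.
have d1 := IH (fun b => F (true :: b)) (fun b => F' (true :: b)) (fun b => h _).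
have d2 := IH (fun b => F (false :: b)) (fun b => F' (false :: b)) (fun b => h _).
exact: is_deriveD (is_deriveZ (1 / 2) d1) (is_deriveZ (1 / 2) d2).
Qed.

(** The mean of [F s] has derivative [- al * e s], with [e] the mean of [phi], and Bobkov's
    inequality gives [Jf (mean) <= be * e s]. As [Qf] has derivative [1 / Jf], the quantile of the
    mean decreases at rate at least [al / be]. *)
Lemma coin_concentration M (g : seq bool -> R) (al be s0 s1 : R) :
  let F s b := Phi (al * (g b - s)) in
  0 < al -> 0 < be -> s0 <= s1 ->
  (forall s b, s0 <= s <= s1 -> size b = M ->
    Num.sqrt (Jf (F s b) ^+ 2 + 2 * pi * D2 (F s) b) <= be * phi (al * (g b - s))) ->
  Qf (EC M (F s1)) <= Qf (EC M (F s0)) - al / be * (s1 - s0).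
Proof.
move=> F al0 be0 s01 h.
have u01 s : 0 < EC M (F s) < 1.
  by apply: EC_itv01 => b; rewrite Phi_gt0 Phi_lt1.
pose e s := EC M (fun b => phi (al * (g b - s))).
have uD (s : R) : is_derive s 1 (fun s => EC M (F s)) (- al * e s).
  rewrite /e -EC_Z; apply: (@is_derive_EC M (fun b s => F s b) (fun b s => - al * phi (al * (g b - s)))).
  move=> b; have iD : is_derive s 1 (fun s => al * (g b - s)) (- al).
    by apply: is_derive_eq; rewrite /GRing.scale/=; ring.
  have := @is_derive1_comp R (@Phi R) _ s _ _ (is_derive_Phi _) iD.
  by rewrite mulrC.
pose W s := - (Qf (EC M (F s)) + al / be * s).
have WD (s : R) : is_derive s 1 W (- ((phi (Qf (EC M (F s))))^-1 * (- al * e s) + al / be)).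
  have d1 := @is_derive1_comp R (@Qf R) _ s _ _ (is_derive_Qf (u01 s)) (uD s).
  have d2 : is_derive s 1 (fun s => al / be * s) (al / be).
    by apply: is_derive_eq; rewrite /GRing.scale/= mulr1.
  exact: is_deriveN (is_deriveD d1 d2).
have : W s0 <= W s1.
  apply: (derive_ge0_le s01 (fun s _ => WD s)) => s ss.
  have bo : Jf (EC M (F s)) <= be * e s.
    rewrite /e -EC_Z; apply: (@le_trans _ _ (EC M (fun b => Num.sqrt (Jf (F s b) ^+ 2 + 2 * pi * D2 (F s) b)))).
      by apply: bobkov_cube => b; rewrite Phi_gt0 Phi_lt1.
    by apply: EC_le => b bM; exact: h.
  have J0 := Jf_gt0 (EC M (F s)).
  have k : al / be <= (Jf (EC M (F s)))^-1 * (al * e s).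
    by rewrite ler_pdivrMr// -mulrA ler_pdivlMl// mulrC -mulrA ler_pM2l// mulrC.
  by rewrite -/(Jf _) opprD mulNr mulrN opprK subr_ge0.
rewrite /W lerN2 mulrBr; clear; lra.
Qed.

Section Gradient.
Variables (n m : nat) (lam d al s K : R) (Y : seq (nat -> R)).
Hypotheses (m0 : (0 < m)%N) (lam0 : 0 < lam) (d0 : 0 < d) (al0 : 0 < al)
  (Y0 : (0 < size Y)%N).
Let N := m.*2.
Let h : R := (Num.sqrt (pi * m%:R))^-1.
Let C : R := d^-1 + 8 * lam.
Let g := softmin n lam d Y.
Let G (k : nat -> nat) := Phi (al * (g (fun i => bincut N (k i)) - s)).
Hypotheses (hlam : 4 * lam * h <= 1)
  (gK : forall k : nat -> nat, `|al * (g (fun i => bincut N (k i)) - s)| <= K).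
(** The discretisation error factor, which tends to 1 as [h] tends to 0 with the other parameters
    fixed. *)
Let psi : R := expR (2 * pi * K * (al * (h + C * h ^+ 2))) ^+ 2 *
               (1 + n%:R * (2 * C * h + C ^+ 2 * h ^+ 2)).

Lemma softmin_grad (b : seq bool) : size b = (n * N)%N ->
  2 * pi * D2 (fun b => G (nth 0%N (blk N n b))) b <=
  phi (al * (g (fun i => bincut N (nth 0%N (blk N n b) i)) - s)) ^+ 2 * (al ^+ 2 * psi).
Proof.
move=> bN; have p0 : 0 < pi :> R := pi_gt0 _.
have mR : 0 < m%:R :> R by rewrite ltr0n.
have h0 : 0 < h by rewrite invr_gt0 sqrtr_gt0 mulr_gt0.
(* The normalisation behind the sharp constant: [2 * pi] times [N / 4] times [h ^+ 2] is exactly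
   1. *)
have h2 : pi * m%:R * h ^+ 2 = 1.
  by rewrite exprVn sqr_sqrtr ?mulr_ge0 ?(ltW p0)// divff// mulf_neq0 ?gt_eqF.
have C0 : 0 <= C by rewrite addr_ge0 ?invr_ge0 ?(ltW d0)// mulr_ge0// ltW.
set k := nth 0%N (blk N n b); set x := fun i => bincut N (k i).
have [v [v1 gv]] := @softmin_taylor R n lam d Y lam0 d0 Y0 x.
set A := al * (g x - s).
set E := expR (2 * pi * K * (al * (h + C * h ^+ 2))).
have vj1 (j : 'I_n) : `|v j| <= 1.
  rewrite -(@ler_pXn2r _ 2)// ?nnegrE// expr1n real_normK ?num_real//.
  apply: le_trans v1; rewrite (bigD1 j)//= lerDl.
  by apply: sumr_ge0 => i _; exact: sqr_ge0.
pose L (j : nat) := (phi A * E * (al * (h * `|v j| + C * h ^+ 2))) ^+ 2.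
have step (j : 'I_n) c t : bincut N c = x j + t -> `|t| <= h ->
    (G (upd k j c) - G k) ^+ 2 <= L j.
  move=> ct th.
  have eu : (fun i => bincut N (upd k j c i)) = upd x j (x j + t).
    by apply/funext => i; rewrite /upd; case: eqP => // _; rewrite ct.
  have gd : `|al * (g (upd x j (x j + t)) - s) - A| <= al * (h * `|v j| + C * h ^+ 2).
    have gen (u w z y : R) : u * (w - z) - u * (y - z) = u * (w - y) by ring.
    rewrite /A gen normrM (gtr0_norm al0) ler_wpM2l ?(ltW al0)//.
    apply: le_trans (gv j t _) _.
      by apply: le_trans hlam; rewrite ler_wpM2l// mulr_ge0// ltW.
    rewrite lerD// ?ler_wpM2r// ler_wpM2l//.
    by rewrite -[leLHS]real_normK ?num_real// ler_pXn2r ?nnegrE// ltW.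
  have gK2 := gK (upd k j c); rewrite eu in gK2.
  rewrite /G eu; apply: (Phi_diff_sqr (gK k) gK2 (ltW al0) (ltW h0) C0 _ gd).
  by rewrite normr_ge0 vj1.
have hD : D2 (fun b => G (nth 0%N (blk N n b))) b <= \sum_(j < n) N%:R / 4 * L j.
  apply: D2_blk => // j jn; split=> kj.
    rewrite -[X in X ^+ 2]opprB sqrrN.
    apply: (step (Ordinal jn) _ (- binw N (k j).-1)).
      by have e := @bincutS R N (k j).-1; rewrite prednK// in e; rewrite /x e addrK.
    by rewrite normrN ger0_norm ?binw_ge0// binw_le.
  apply: (step (Ordinal jn) _ (binw N (k j))); first by rewrite bincutS.
  by rewrite ger0_norm ?binw_ge0// binw_le.
apply: le_trans (ler_wpM2l _ hD) _; first by rewrite mulr_ge0// ltW.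
have eL (j : 'I_n) : N%:R / 4 * L j =
    N%:R / 4 * (phi A ^+ 2 * al ^+ 2 * E ^+ 2) * h ^+ 2 * (`|v j| + C * h) ^+ 2.
  have gen (q u a w y z c : R) : q * (u * w * (a * (y * z + c * y ^+ 2))) ^+ 2 =
    q * (u ^+ 2 * a ^+ 2 * w ^+ 2) * y ^+ 2 * (z + c * y) ^+ 2 by ring.
  exact: gen.
rewrite (eq_bigr _ (fun j _ => eL j)) -mulr_sumr.
have NR : N%:R = 2 * m%:R :> R by rewrite /N -mul2n natrM.
have -> : 2 * pi * (N%:R / 4 * (phi A ^+ 2 * al ^+ 2 * E ^+ 2) * h ^+ 2 *
   \sum_(j < n) (`|v j| + C * h) ^+ 2) =
   phi A ^+ 2 * (al ^+ 2 * E ^+ 2) * \sum_(j < n) (`|v j| + C * h) ^+ 2.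
  transitivity (pi * m%:R * h ^+ 2 * (phi A ^+ 2 * (al ^+ 2 * E ^+ 2) * \sum_(j < n) (`|v j| + C * h) ^+ 2)).
    have gen (q u w z a y M : R) : 2 * q * (2 * M / 4 * (u ^+ 2 * a ^+ 2 * w ^+ 2) * y ^+ 2 * z) =
      q * M * y ^+ 2 * (u ^+ 2 * (a ^+ 2 * w ^+ 2) * z) by field.
    by rewrite NR; exact: gen.
  by rewrite h2 mul1r.
have assoc (u a w z : R) : u * (a * w) * z = u * (a * (w * z)) by ring.
rewrite /psi -/E assoc.
rewrite ler_wpM2l ?sqr_ge0// ler_wpM2l ?sqr_ge0// ler_wpM2l ?sqr_ge0//.
have -> : 1 + n%:R * (2 * C * h + C ^+ 2 * h ^+ 2) =
    1 + \sum_(j < n) (2 * C * h + C ^+ 2 * h ^+ 2).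
  by rewrite sumr_const card_ord mulr_natl.
apply: (@le_trans _ _ (\sum_(j < n) v j ^+ 2 + \sum_(j < n) (2 * C * h + C ^+ 2 * h ^+ 2))).
  rewrite -big_split/=; apply: ler_sum => j _.
  rewrite sqrrD real_normK ?num_real// -addrA lerD2l exprMn lerD2r.
  rewrite mulr2n; have Ch : 0 <= C * h by rewrite mulr_ge0// ltW.
  have := ler_wpM2r Ch (vj1 j); rewrite mul1r; lra.
by rewrite lerD2r.
Qed.

Lemma softmin_grad_sqrt (b : seq bool) : size b = (n * N)%N ->
  Num.sqrt (Jf (G (nth 0%N (blk N n b))) ^+ 2 + 2 * pi * D2 (fun b => G (nth 0%N (blk N n b))) b) <=
  Num.sqrt (1 + al ^+ 2 * psi) * phi (al * (g (fun i => bincut N (nth 0%N (blk N n b) i)) - s)).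
Proof.
move=> bN; set A := al * _.
rewrite -[X in _ <= _ * X]ger0_norm ?(ltW (phi_gt0 _))// -sqrtr_sqr -sqrtrM; last first.
  rewrite addr_ge0// mulr_ge0 ?sqr_ge0// mulr_ge0 ?sqr_ge0// addr_ge0// mulr_ge0//.
  have C0 : 0 <= C by rewrite addr_ge0 ?invr_ge0 ?(ltW d0)// mulr_ge0// ltW.
  have h0 : 0 <= h by rewrite invr_ge0 sqrtr_ge0.
  by rewrite addr_ge0// mulr_ge0 ?sqr_ge0 ?mulr_ge0.
apply: ler_wsqrtr; rewrite {1}/G /Jf PhiK -/A [leRHS]mulrDl mul1r lerD2l.
by rewrite [leRHS]mulrC; exact: softmin_grad.
Qed.

End Gradient.

End Concentration.

(** * Isoperimetry in the cube *)

Section Approximation.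
Context {R : realType}.

(** The net must lie in [D], since its points will stand for points outside [B]. So [D] is sliced by
    the last coordinate into slabs of width [del], and each slab gets its own net by induction. *)
Lemma finite_net n (D : set (nat -> R)) (del : R) : 0 < del ->
  (forall y j, D y -> (j < n)%N -> 0 <= y j <= 1) ->
  exists Y : seq (nat -> R), (forall y, y \in Y -> D y) /\
    (forall y, D y -> exists2 z, z \in Y & forall j, (j < n)%N -> `|y j - z j| <= del).
Proof.
move=> del0; elim: n D => [|n IH] D D01.
  have [[y Dy]|nD] := pselect (exists y, D y).
    exists [:: y]; split=> [z|z Dz]; first by rewrite inE => /eqP ->.
    by exists y; rewrite ?inE.
  exists [::]; split=> // y Dy; exfalso; apply: nD; by exists y.
pose Dk k : set (nat -> R) := [set y | D y /\ k%:R * del <= y n <= k.+1%:R * del].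
have /choice[Y HY] : forall k, exists Y : seq (nat -> R), (forall y, y \in Y -> Dk k y) /\
    (forall y, Dk k y -> exists2 z, z \in Y & forall j, (j < n)%N -> `|y j - z j| <= del).
  by move=> k; apply: IH => y j [Dy _] jn; apply: D01 => //; exact: ltnW.
pose M := Num.bound del^-1.
exists (flatten [seq Y k | k <- iota 0 M.+1]); split.
  by move=> y /flattenP[s /mapP[k _ ->]] /(HY k).1 [].
move=> y Dy.
have /andP[y0 y1] := D01 _ n Dy (ltnSn n).
pose k := Num.truncn (y n / del).
have ydel : 0 <= y n / del by rewrite divr_ge0// ltW.
have /andP[k1 k2] := truncn_itv ydel.
have Dky : Dk k y.
  split=> //; rewrite -ler_pdivlMr// k1/= -ler_pdivrMr//; exact: ltW.
have [z zY hz] := (HY k).2 _ Dky.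
exists z.
  apply/flattenP; exists (Y k) => //; apply: map_f; rewrite mem_iota/= add0n ltnS.
  rewrite -(ler_nat R) (le_trans k1)// ltW// (le_lt_trans _ (archi_boundP _)) ?invr_ge0 ?(ltW del0)//.
  by rewrite -[leRHS]mul1r ler_wpM2r// invr_ge0 ltW.
move=> j; rewrite ltnS leq_eqVlt => /predU1P[->|/hz//].
have [_ /andP[h1 h2]] := (HY k).1 _ zY.
have /= [_ /andP[h3 h4]] := Dky.
move: h2 h4; rewrite -natr1 mulrDl mul1r ler_norml => h2 h4; lra.
Qed.

Lemma sqd_triangle n (x X y : nat -> R) (A B : R) : 0 < A -> 0 < B ->
  sqd n X y <= A ^+ 2 -> sqd n x X <= B ^+ 2 -> sqd n x y <= (A + B) ^+ 2.
Proof.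
move=> A0 B0 hA hB.
pose P := \sum_(i < n) (x i - X i) * (X i - y i).
have e : sqd n x y = sqd n x X + 2 * P + sqd n X y.
  rewrite /sqd /P mulr_sumr -!big_split/=; apply: eq_bigr => i _; ring.
have h : 0 <= A ^+ 2 * sqd n x X - 2 * (A * B) * P + B ^+ 2 * sqd n X y.
  have -> : A ^+ 2 * sqd n x X - 2 * (A * B) * P + B ^+ 2 * sqd n X y =
      \sum_(i < n) (A * (x i - X i) - B * (X i - y i)) ^+ 2.
    rewrite /sqd /P !mulr_sumr -sumrN -!big_split/=; apply: eq_bigr => i _; ring.
  by apply: sumr_ge0 => i _; exact: sqr_ge0.
have PAB : P <= A * B.
  rewrite -(ler_pM2l (mulr_gt0 A0 B0)).
  have := ler_wpM2l (sqr_ge0 A) hB; have := ler_wpM2l (sqr_ge0 B) hA.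
  rewrite -!exprMn; lra.
rewrite e; have -> : (A + B) ^+ 2 = B ^+ 2 + 2 * (A * B) + A ^+ 2 by ring.
by lra.
Qed.

(** The factor [n.+1] is cruder than [sqrt n] but free of roots and positive for every [n]. *)
Lemma sqd_le_sup n (x y : nat -> R) (del : R) : 0 <= del ->
  (forall j, (j < n)%N -> `|x j - y j| <= del) -> sqd n x y <= (n.+1%:R * del) ^+ 2.
Proof.
move=> del0 h; apply: (@le_trans _ _ (\sum_(i < n) del ^+ 2)).
  apply: ler_sum => i _; rewrite -real_normK ?num_real//.
  by rewrite ler_pXn2r ?nnegrE//; apply: h.
rewrite sumr_const card_ord -[leLHS]mulr_natl exprMn ler_wpM2r ?sqr_ge0//.
rewrite -natrX ler_nat (leq_trans (leqnSn n))// -{1}[n.+1]expn1 leq_pexp2l//.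
Qed.

Lemma small_perturbation (c C th : R) n : 0 <= c -> 0 <= C -> 0 < th ->
  exists2 h0 : R, 0 < h0 & forall h, 0 <= h <= h0 ->
    expR (c * (h + C * h ^+ 2)) ^+ 2 * (1 + n%:R * (2 * C * h + C ^+ 2 * h ^+ 2)) <= 1 + th.
Proof.
move=> c0 C0 th0.
(* For [h <= 1] one has [h ^+ 2 <= h], and [c' * h] then dominates the exponent; the final 1 keeps
   [c'] positive. *)
pose c' := 2 * c * (1 + C) + n%:R * (2 * C + C ^+ 2) + 1.
have c'0 : 0 < c'.
  by rewrite /c' ltr_wpDl// addr_ge0// mulr_ge0 ?mulr_ge0 ?addr_ge0 ?sqr_ge0 ?mulr_ge0.
have l0 : 0 < ln (1 + th) by rewrite ln_gt0// ltrDl.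
exists (Num.min 1 (ln (1 + th) / c')); first by rewrite lt_min ltr01 divr_gt0.
move=> h /andP[h0]; rewrite le_min => /andP[h1 hl].
rewrite -(lnK (x := 1 + th)) ?posrE ?addr_gt0//.
apply: (@le_trans _ _ (expR (c * (h + C * h ^+ 2)) ^+ 2 * expR (n%:R * (2 * C * h + C ^+ 2 * h ^+ 2)))).
  by rewrite ler_wpM2l ?sqr_ge0// expR_ge1Dx.
rewrite expr2 -!expRD ler_expR; rewrite ler_pdivlMr// in hl.
have hh : h ^+ 2 <= h by rewrite expr2 ler_piMl.
apply: le_trans hl; rewrite /c'.
have k1 : c * (h + C * h ^+ 2) <= c * ((1 + C) * h).
  by rewrite ler_wpM2l// mulrDl mul1r lerD2l ler_wpM2l.
have k2 : n%:R * (2 * C * h + C ^+ 2 * h ^+ 2) <= n%:R * ((2 * C + C ^+ 2) * h).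
  by rewrite ler_wpM2l// [leRHS]mulrDl lerD2l ler_wpM2l// sqr_ge0.
lra.
Qed.

Lemma small_step (h0 : R) : 0 < h0 -> exists2 m, (0 < m)%N & (Num.sqrt (pi * m%:R))^-1 <= h0.
Proof.
move=> h00.
have h2 : 0 <= (h0 ^+ 2)^-1 by rewrite invr_ge0 sqr_ge0.
exists (Num.bound (h0 ^+ 2)^-1).+1 => //.
have p1 : 1 <= pi :> R by rewrite (le_trans _ (pi_ge2 _))// ler1n.
have p0 : 0 < pi :> R := pi_gt0 _.
have k : (h0 ^+ 2)^-1 <= pi * (Num.bound (h0 ^+ 2)^-1).+1%:R.
  apply: le_trans (ltW (archi_boundP h2)) _.
  apply: (@le_trans _ _ (Num.bound (h0 ^+ 2)^-1).+1%:R); first by rewrite ler_nat.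
  by rewrite ler_peMl.
have k0 : 0 < (h0 ^+ 2)^-1 by rewrite invr_gt0 exprn_gt0.
have s0 : 0 < Num.sqrt (pi * (Num.bound (h0 ^+ 2)^-1).+1%:R) :> R.
  by rewrite sqrtr_gt0 (lt_le_trans k0).
rewrite -[leRHS]invrK lef_pV2 ?posrE ?invr_gt0//.
have -> : h0^-1 = Num.sqrt ((h0 ^+ 2)^-1).
  by rewrite -exprVn sqrtr_sqr ger0_norm// invr_ge0 ltW.
exact: ler_wsqrtr.
Qed.

Lemma lvol_cube n : lvol (@cube R n) = 1%E.
Proof.
(* Without coins there is a single cell, the whole unit interval. *)
have -> : @cube R n = boxes 0 predT by apply/seteqP; split=> x //= [].
by rewrite lvol_boxes -EC_blk EC_cst.
Qed.

End Approximation.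

Section CubeIsoperimetry.
Context {R : realType}.

Lemma nth_cell N n (t : n.-tuple R) (l : seq nat) j : (j < n)%N ->
  [seq cell N i | i <- t] = l -> nth 0%N l j = cell N (nth 0 t j).
Proof. by move=> jn <-; rewrite (nth_map 0)// size_tuple. Qed.

Lemma nth_cube n (t : n.-tuple R) j : cube t -> (j < n)%N -> 0 <= nth 0 t j <= 1.
Proof. by move=> ct jn; have := ct (Ordinal jn); rewrite (tnth_nth 0). Qed.

Lemma bincut_near m n (t : n.-tuple R) (l : seq nat) j : (0 < m)%N -> cube t -> (j < n)%N ->
  [seq cell m.*2 i | i <- t] = l ->
  `|bincut m.*2 (nth 0%N l j) - nth 0 t j| <= (Num.sqrt (pi * m%:R))^-1.
Proof.
move=> m0 ct jn e; rewrite (nth_cell jn e).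
have := cell_bounds m.*2 (nth_cube ct jn).
have := binw_le (R := R) (cell m.*2 (nth 0 t j)) m0.
rewrite bincutS ler_norml; set h := _^-1 => k1 k2.
have := binw_ge0 (R := R) m.*2 (cell m.*2 (nth 0 t j)); lra.
Qed.

(** Beyond [N.+1] the binomial weights vanish, so the bound holds for every index. *)
Lemma bincut_itv N k : 0 <= (bincut N k : R) <= 1.
Proof.
rewrite -{1}(bincut0 N) bincut_le//=.
have [kN|Nk] := leqP k N.+1; first by rewrite -(bincut1 N) bincut_le.
suff -> : bincut N k = 1 :> R by [].
rewrite -(subnKC (ltnW Nk)); elim: (k - N.+1)%N => [|i IH]; first by rewrite addn0 bincut1.
by rewrite addnS bincutS IH /binw bin_small ?mul0r ?addr0// leq_addr.
Qed.

(* [al] is the slope of the soft indicator [Phi (al * (dist - s))], [1 - th] the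
   resulting loss in the concentration rate and [sg] the spatial error. *)
Lemma concentration_constants (a r : R) : 0 <= a < 1 / 2 -> 0 < r ->
  exists sg th al, [/\ 0 < sg, 2 * sg <= r, 0 < th, 1 <= al & 1 <= al * th] /\
  forall u0 u1, 0 < u0 < 1 -> 0 < u1 < 1 ->
    u0 <= a + Phi (- (al * (sg / 2))) -> 1 / 2 * phi r * Phi (al * (sg / 2)) <= u1 ->
    ~ (Qf u1 <= Qf u0 - (1 - th) * (r - sg - sg)).
Proof.
move=> /andP[a0 a2] r0.
pose a1 := (a + 1 / 2) / 2.
have a01 : 0 < a1 < 1 by rewrite /a1; lra.
(* The slack [a < 1 / 2] on the quantile scale, measured at the midpoint [a1]; all errors are
   fractions of [kap]. *)
pose kap := - Qf a1.
have Pkap : Phi (- kap) = a1 by rewrite opprK QfK.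
have kap0 : 0 < kap.
  by rewrite oppr_gt0 -Phi_ltP QfK// Phi0 /a1; lra.
pose th := kap / (4 * r).
have th0 : 0 < th by rewrite divr_gt0// mulr_gt0.
have thr : th * r = kap / 4 by rewrite /th; field; rewrite gt_eqF.
pose sg := Num.min (kap / 8) (r / 4).
have sg0 : 0 < sg by rewrite lt_min !divr_gt0.
have sgk : sg <= kap / 8 by rewrite ge_min lexx.
have sgr : sg <= r / 4 by rewrite ge_min lexx orbT.
(* [Phi q > ratio] makes the lower bound on [u1] exceed [Phi (- kap / 2 - r)];
   [Phi q > 1 - (a1 - a)] keeps [u0] below [a1]. *)
pose ratio := Phi (- kap / 2 - r) / Phi (- r).
have ratio1 : ratio < 1.
  by rewrite ltr_pdivrMr ?Phi_gt0// mul1r Phi_ltP; lra.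
pose p1 := Num.max ratio (1 - (a1 - a)).
have p101 : 0 < p1 < 1.
  rewrite lt_max gt_max ratio1 /a1 /=; apply/andP; split; last by lra.
  by apply/orP; right; lra.
pose z := Qf p1.
(* The three summands give in turn [q = al * sg / 2] beyond [z], [al * th >= 1] and [al >= 1]. *)
pose al := 2 * `|z| / sg + th^-1 + 1.
have thV : 0 < th^-1 by rewrite invr_gt0.
have zsg : 0 <= 2 * `|z| / sg by rewrite divr_ge0 ?(ltW sg0)// mulr_ge0.
have al0 : 1 <= al by rewrite /al; lra.
have al1 : 1 <= al * th.
  have -> : al * th = 1 + (2 * `|z| / sg + 1) * th by rewrite /al; field; rewrite !gt_eqF.
  by rewrite lerDl mulr_ge0 ?(ltW th0)//; lra.
pose q := al * (sg / 2).
have qz : z < q.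
  have -> : q = `|z| + (th^-1 + 1) * (sg / 2) by rewrite /q /al; field; rewrite !gt_eqF.
  rewrite (le_lt_trans (ler_norm z))// ltrDl mulr_gt0//; lra.
have Pq : p1 < Phi q by rewrite -(QfK p101) Phi_ltP.
have Pq1 : ratio < Phi q by rewrite (le_lt_trans _ Pq)// le_max lexx.
have Pq2 : Phi (- q) <= a1 - a.
  have : 1 - (a1 - a) < Phi q by rewrite (le_lt_trans _ Pq)// le_max lexx orbT.
  by rewrite PhiN; lra.
exists sg, th, al; split; first by split=> //; lra.
rewrite -/q => u0 u1 u001 u101 U0 U1 main.
(* From [Qf u0 <= - kap], the losses [2 * sg <= kap / 4] and [th * r = kap / 4] together consume
   half of the slack. *)
have Q1 : Qf u1 <= - kap / 2 - r.
  apply: le_trans main _.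
  have k1 : Qf u0 <= - kap by rewrite opprK Qf_le//; move: U0 Pq2; clear; lra.
  have k3 : 0 <= th * sg by rewrite mulr_ge0// ltW.
  have k4 : (1 - th) * (r - sg - sg) = r - 2 * sg - th * r + 2 * (th * sg) by ring.
  rewrite k4 thr; move: k1 k3 sgk; clear; lra.
have : Phi (Qf u1) <= Phi (- kap / 2 - r) by exact: Phi_le.
rewrite QfK//.
have -> : Phi (- kap / 2 - r) = ratio * Phi (- r) by rewrite divfK// gt_eqF// Phi_gt0.
have k5 : ratio * Phi (- r) < Phi q * Phi (- r) by rewrite ltr_pM2r// Phi_gt0.
have k6 : Phi q * Phi (- r) <= Phi q * (1 / 2 * phi r).
  by rewrite ler_pM2l ?Phi_gt0//; exact: Phi_tail (ltW r0).
by move: U1 k5 k6; rewrite (mulrC _ (Phi q)); clear; lra.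
Qed.

(** The coins are taken numerous enough for [psi <= 1 + th]. Then [al * th >= 1] absorbs the 1 under
    the root: [be <= al * (1 + th)], hence [al / be >= 1 - th]. *)
Lemma softmin_concentration n (Y : seq (nat -> R)) (lam d r al th h1 : R) :
  (forall y j, y \in Y -> (j < n)%N -> 0 <= y j <= 1) -> (0 < size Y)%N ->
  0 < lam -> 0 < d -> 0 < r -> 0 < th -> 1 <= al -> 1 <= al * th -> 0 < h1 ->
  exists m, [/\ (0 < m)%N, (Num.sqrt (pi * m%:R))^-1 <= h1 &
    let F s b := Phi (al * (softmin n lam d Y
                              (fun i => bincut m.*2 (nth 0%N (blk m.*2 n b) i)) - s)) in
    forall s0 s1, 0 <= s0 -> s0 <= s1 -> s1 <= r ->
    Qf (EC (n * m.*2) (F s1)) <= Qf (EC (n * m.*2) (F s0)) - (1 - th) * (s1 - s0)].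
Proof.
move=> Y01 Y0 lam0 d0 r0 th0 al1 alth h10.
have p0 : 0 < pi :> R := pi_gt0 _.
have al0 : 0 < al by exact: lt_le_trans al1.
pose lY := ln (size Y)%:R : R.
have lY0 : 0 <= lY by rewrite ln_ge0// ler1n.
have lYlam0 : 0 <= lY / lam by rewrite divr_ge0// ltW.
pose C := d^-1 + 8 * lam.
have C0 : 0 <= C by rewrite addr_ge0 ?invr_ge0 ?(ltW d0)// mulr_ge0// ltW.
have n1 : 0 < n.+1%:R :> R by rewrite ltr0n.
pose G0 := n.+1%:R + d + lY / lam.
have G00 : 0 <= G0 by rewrite /G0; move: n1 d0 lYlam0; clear; lra.
pose K := al * (G0 + r).
have K0 : 0 <= K by rewrite mulr_ge0 ?(ltW al0)// addr_ge0// ltW.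
have c0 : 0 <= 2 * pi * K * al.
  by apply: mulr_ge0 (ltW al0); apply: mulr_ge0 K0; apply: mulr_ge0 (ltW p0).
have [h0 h00 Hpsi] := small_perturbation n c0 C0 th0.
have [m m0] : exists2 m, (0 < m)%N & (Num.sqrt (pi * m%:R))^-1 <= Num.min h0 (Num.min h1 (4 * lam)^-1).
  by apply: small_step; rewrite !lt_min h00 h10 invr_gt0 mulr_gt0.
set h := (Num.sqrt _)^-1; rewrite !le_min => /and3P[hh0 hh1 hlam].
have hge0 : 0 <= h by rewrite invr_ge0 sqrtr_ge0.
have {}hlam : 4 * lam * h <= 1.
  by rewrite mulrC -ler_pdivlMr ?mulr_gt0// mul1r.
exists m; split=> // F s0 s1 s00 s01 s1r.
pose N := m.*2.
pose g := softmin n lam d Y.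
have gbound (k : nat -> nat) : `|g (fun i => bincut N (k i))| <= G0.
  rewrite ler_norml; apply/andP; split.
    have : 0 - lY / lam <= g (fun i => bincut N (k i)).
      by apply: (softmin_ge lam0 Y0) => i _; exact/ltW/sdist_gt0.
    by rewrite /G0; move: n1 d0; clear; lra.
  apply: (@le_trans _ _ (n.+1%:R + d)); last by rewrite lerDl.
  apply: softmin_le => //; exists 0%N => //; set y := nth _ _ _.
  have Dy : y \in Y by apply: mem_nth.
  have nd : 0 <= n.+1%:R + d by rewrite addr_ge0// ltW.
  rewrite -(ler_pXn2r (n := 2))// ?nnegrE// ?(ltW (sdist_gt0 _ _ _ _))// sdist_sqr.
  have : sqd n (fun i => bincut N (k i)) y <= (n.+1%:R * 1) ^+ 2.
    apply: sqd_le_sup => // j jn; rewrite ler_norml.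
    by have := Y01 _ _ Dy jn; have := bincut_itv N (k j); clear; lra.
  rewrite mulr1 sqrrD.
  have : 0 <= n.+1%:R * d by rewrite mulr_ge0// ltW.
  by clear; lra.
have gK s : s0 <= s <= s1 -> forall k : nat -> nat,
    `|al * (g (fun i => bincut N (k i)) - s)| <= K.
  move=> /andP[k1 k2] k; rewrite normrM (gtr0_norm al0) ler_wpM2l ?(ltW al0)//.
  apply: le_trans (ler_normB _ _) _; rewrite lerD ?gbound// ger0_norm.
    exact: le_trans k2 s1r.
  exact: le_trans s00 k1.
pose psi := expR (2 * pi * K * (al * (h + C * h ^+ 2))) ^+ 2 *
               (1 + n%:R * (2 * C * h + C ^+ 2 * h ^+ 2)).
have psi1 : psi <= 1 + th.
  by rewrite /psi mulrA; apply: Hpsi; rewrite hge0.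
have psi0 : 0 <= psi.
  rewrite mulr_ge0 ?sqr_ge0// addr_ge0// mulr_ge0// addr_ge0// mulr_ge0 ?sqr_ge0//.
  by rewrite mulr_ge0.
pose be := Num.sqrt (1 + al ^+ 2 * psi).
have be0 : 0 < be by rewrite sqrtr_gt0 ltr_pwDl// mulr_ge0// sqr_ge0.
have be1 : be <= al * (1 + th).
  have th1 : 0 <= 1 + th by rewrite addr_ge0// ltW.
  have alth1 : 0 <= al * (1 + th) by rewrite mulr_ge0// ltW.
  rewrite -(ger0_norm alth1) -sqrtr_sqr; apply: ler_wsqrtr.
  have k1 : al ^+ 2 * psi <= al ^+ 2 * (1 + th) by rewrite ler_wpM2l// sqr_ge0.
  have k2 : 1 <= (al * th) * al.
    by rewrite (le_trans alth)// ler_peMr// (le_trans _ alth).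
  have k3 : 0 <= (al * th) ^+ 2 by exact: sqr_ge0.
  have -> : (al * (1 + th)) ^+ 2 = al ^+ 2 * (1 + th) + (al * th) * al + (al * th) ^+ 2 by ring.
  by move: k1 k2 k3; clear; lra.
have main : Qf (EC (n * N) (F s1)) <= Qf (EC (n * N) (F s0)) - al / be * (s1 - s0).
  apply: (@coin_concentration R (n * N)
    (fun b => g (fun i => bincut N (nth 0%N (blk N n b) i))) al be s0 s1) => //.
  move=> s b ss bN.
  exact: (@softmin_grad_sqrt R n m lam d al s K Y m0 lam0 d0 al0 Y0 hlam (gK s ss) b bN).
have rho : 1 - th <= al / be.
  rewrite ler_pdivlMr//.
  have [th1|th1] := leP th 1; last first.
    by rewrite (le_trans _ (ltW al0))// nmulr_rle0 ?(ltW be0)// subr_lt0.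
  apply: (@le_trans _ _ ((1 - th) * (al * (1 + th)))).
    by rewrite ler_wpM2l// subr_ge0.
  have -> : (1 - th) * (al * (1 + th)) = al - al * th ^+ 2 by ring.
  by rewrite gerBl mulr_ge0 ?sqr_ge0// ltW.
apply: le_trans main _; rewrite lerD2l lerN2 ler_wpM2r// subr_ge0//.
Qed.

Lemma cube_isoperimetry n (B S : set (n.-tuple R)) (r : R) :
  measurable B -> (lvol B < (1 / 2)%:E)%E -> 0 < r -> S `<=` @cube R n ->
  (forall x y, S x -> cube y -> ~ B y -> r ^+ 2 <= sqd n (nth 0 x) (nth 0 y)) ->
  (vol S < (1 / 2 * phi r)%:E)%E.
Proof.
move=> mB hB r0 Sc sep; rewrite ltNge; apply/negP => hS.
have fB : lvol B \is a fin_num by rewrite ge0_fin_numE ?lvol_ge0// (lt_trans hB) ?ltry.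
pose a := fine (lvol B).
have aE : lvol B = a%:E by rewrite fineK.
have a02 : 0 <= a < 1 / 2 by rewrite -lee_fin -lte_fin -aE lvol_ge0.
have [sg [th [al [[sg0 sgr th0 al1 alth] absurd]]]] := concentration_constants a02 r0.
have al0 : 0 < al by exact: lt_le_trans al1.
pose d := sg / 4.
have d0 : 0 < d by rewrite divr_gt0.
have n1 : 0 < n.+1%:R :> R by rewrite ltr0n.
pose del := sg / (8 * n.+1%:R).
have del0 : 0 < del by rewrite divr_gt0// mulr_gt0.
have ndel : n.+1%:R * del = sg / 8 by rewrite /del; field; rewrite gt_eqF.
pose D : set (nat -> R) := [set y | exists t : n.-tuple R, [/\ cube t, ~ B t & y = nth 0 t]].
have D01 y j : D y -> (j < n)%N -> 0 <= y j <= 1.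
  by move=> [t [ct _ ->]] jn; exact: nth_cube.
have [Y [YD Ynet]] := finite_net del0 D01.
have Y0 : (0 < size Y)%N.
  have [[t [ct Bt]]|nD] := pselect (exists t : n.-tuple R, cube t /\ ~ B t).
    have [|y + _] := Ynet (nth 0 t); first by exists t.
    by case: (Y).
  have cB : @cube R n `<=` B by move=> t ct; apply: contrapT => Bt; apply: nD; exists t.
  have : (lvol (@cube R n) <= lvol B)%E.
    by apply: le_measure => //; rewrite inE//; exact: measurable_cube.
  by rewrite lvol_cube aE lee_fin; move: a02; clear; lra.
pose lY := ln (size Y)%:R : R.
have lY0 : 0 <= lY by rewrite ln_ge0// ler1n.
(* Keeps the log-sum-exp error [lY / lam] below [sg / 4]; the summand 1 makes [lam] positive even
   for a one-point net. *)
pose lam := 1 + 4 * lY / sg.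
have lam0 : 0 < lam by rewrite ltr_pwDl// divr_ge0 ?(ltW sg0)// mulr_ge0.
have lYlam : lY / lam <= sg / 4.
  rewrite ler_pdivrMr// /lam mulrDr mulr1.
  have gen (u w : R) : 0 < w -> w / 4 * (4 * u / w) = u by move=> w0; field; rewrite gt_eqF.
  rewrite gen//.
  by rewrite lerDr divr_ge0// ltW.
have Y01 y j : y \in Y -> (j < n)%N -> 0 <= y j <= 1 by move=> /YD; exact: D01.
have [m [m0 hdel]] := softmin_concentration Y01 Y0 lam0 d0 r0 th0 al1 alth del0.
set F := (X in let F := X in _) => conc.
pose N := m.*2.
pose g := softmin n lam d Y.
pose X b := fun i => bincut N (nth 0%N (blk N n b) i) : R.
(* Boxes meeting the complement of [B], and below boxes meeting [S]. The boxes failing [PB] lie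
   inside [B], and those satisfying [PS] cover [S], so both volumes become coin probabilities with
   inequalities in the right direction. *)
pose PB (l : seq nat) := `[< exists t : n.-tuple R, [/\ cube t, ~ B t & [seq cell N i | i <- t] = l] >].
have PBa : EB N n (fun l => (~~ PB l)%:R) <= a.
  rewrite -lee_fin -aE -(lvol_boxes N n (fun l => ~~ PB l)).
  apply: le_measure; rewrite ?inE//; first exact: measurable_boxes.
  move=> t [ct /asboolPn nt]; apply: contrapT => Bt; apply: nt; by exists t.
pose PS (l : seq nat) := `[< exists2 t : n.-tuple R, S t & [seq cell N i | i <- t] = l >].
have PSb : 1 / 2 * phi r <= EB N n (fun l => (PS l)%:R).
  rewrite -lee_fin -(lvol_boxes N n PS); apply: le_trans hS _.
  apply: ereal_inf_lbound; exists (boxes N PS) => //; split; first exact: measurable_boxes.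
  by move=> t St; split; [exact: Sc|apply/asboolP; exists t].
have nearB b : PB (blk N n b) -> g (X b) <= sg / 2.
  move=> /asboolP[t [ct Bt tb]].
  have [y yY hy] : exists2 y, y \in Y & forall j, (j < n)%N -> `|nth 0 t j - y j| <= del.
    by apply: Ynet; exists t.
  have [i iY ey] := nthP (fun=> 0) yY.
  apply: softmin_le => //; exists i => //; rewrite ey.
  rewrite -(ler_pXn2r (n := 2))// ?nnegrE// ?(ltW (sdist_gt0 _ _ _ _))//; last first.
    by rewrite divr_ge0// ltW.
  rewrite sdist_sqr.
  (* One [del] for the distance from the cut to a point of its cell, one for the net. *)
  have : sqd n (X b) y <= (n.+1%:R * (2 * del)) ^+ 2.
    apply: sqd_le_sup => [|j jn]; first by rewrite mulr_ge0// ltW.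
    have k1 := le_trans (bincut_near m0 ct jn tb) hdel; have k2 := hy j jn.
    rewrite -(subrKA (nth 0 t j)) (le_trans (ler_normD _ _))//.
    by move: k1 k2; rewrite -/(X b j); clear; lra.
  have -> : n.+1%:R * (2 * del) = 2 * (n.+1%:R * del) by ring.
  by rewrite ndel /d; have := sqr_ge0 sg; clear; nra.
have nearS b : PS (blk N n b) -> r - sg / 2 <= g (X b).
  move=> /asboolP[t St tb].
  apply: (@le_trans _ _ (r - sg / 8 - lY / lam)); first by move: lYlam sg0; clear; lra.
  apply: (softmin_ge lam0 Y0) => i iY; set y := nth _ Y i.
  have [t' [ct' Bt' ey]] : D y by apply: YD; apply: mem_nth.
  have A0 : 0 < sdist n d (X b) y by exact: sdist_gt0.
  have B0 : 0 < n.+1%:R * del by rewrite mulr_gt0.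
  have sA : sqd n (X b) y <= sdist n d (X b) y ^+ 2 by rewrite sdist_sqr lerDl sqr_ge0.
  have sB : sqd n (nth 0 t) (X b) <= (n.+1%:R * del) ^+ 2.
    apply: sqd_le_sup => [|j jn]; first exact: ltW.
    rewrite distrC; apply: le_trans hdel; exact: bincut_near m0 (Sc _ St) jn tb.
  have tri := sqd_triangle A0 B0 sA sB.
  have : r <= sdist n d (X b) y + n.+1%:R * del.
    rewrite -(ler_pXn2r (n := 2))// ?nnegrE ?(ltW r0) ?addr_ge0 ?(ltW A0) ?(ltW B0)//.
    by apply: le_trans tri; rewrite ey; exact: sep.
  by rewrite ndel; clear; lra.
(* The level runs from [sg] to [r - sg], so that at either end the argument of [Phi] is at least
   [al * (sg / 2)] away from 0 on the relevant boxes. *)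
have U0 : EC (n * N) (F sg) <= a + Phi (- (al * (sg / 2))).
  apply: (@le_trans _ _ (EC (n * N) (fun b => (~~ PB (blk N n b))%:R + Phi (- (al * (sg / 2)))))).
    apply: EC_le => b bN.
    case PBb : (PB _); last first.
      by rewrite (le_trans (ltW (Phi_lt1 _)))// lerDl ltW// Phi_gt0.
    rewrite add0r Phi_leP -mulrN ler_pM2l//.
    by have := nearB b PBb; rewrite /g /X; clear; lra.
  by rewrite EC_D EC_cst (EC_blk N n (fun l => (~~ PB l)%:R)) lerD2r.
have U1 : 1 / 2 * phi r * Phi (al * (sg / 2)) <= EC (n * N) (F (r - sg)).
  apply: (@le_trans _ _ (EC (n * N) (fun b => Phi (al * (sg / 2)) * (PS (blk N n b))%:R))).
    rewrite EC_Z (EC_blk N n (fun l => (PS l)%:R)) mulrC ler_wpM2l//.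
    by apply: ltW; exact: Phi_gt0.
  apply: EC_le => b bN.
  case PSs : (PS _); last by rewrite mulr0; apply: ltW; exact: Phi_gt0.
  rewrite mulr1 Phi_leP ler_pM2l//.
  by have := nearS b PSs; rewrite /g /X; clear; lra.
have u01 s : 0 < EC (n * N) (F s) < 1.
  by apply: EC_itv01 => b; rewrite Phi_gt0 Phi_lt1.
apply: absurd (u01 sg) (u01 (r - sg)) U0 U1 _.
by apply: conc; [exact: ltW| |]; move: sg0 sgr; clear; lra.
Qed.

End CubeIsoperimetry.

(** * Hamming distance *)

Section Hamming.
Context {R : realType}.
Notation leb := (@lebesgue_measure R).
Notation I01 := (`[0, 1]%classic : set R).

(** Convexity, from the tangent at [l * u] evaluated at 0 and at [l]. *)
Lemma expR_chord (u l : R) : 0 <= u <= 1 -> expR (l * u) <= 1 + (expR l - 1) * u.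
Proof.
move=> /andP[u0 u1].
have tangent (w y : R) : expR w * (1 + (y - w)) <= expR y.
  by rewrite -[in leRHS](subrKC w y) expRD ler_wpM2l ?expR_ge0// expR_ge1Dx.
have h0 := tangent (l * u) 0; have hl := tangent (l * u) l.
rewrite expR0 sub0r in h0.
have -> : expR (l * u) = (1 - u) * (expR (l * u) * (1 - l * u)) +
    u * (expR (l * u) * (1 + (l - l * u))) by ring.
have -> : 1 + (expR l - 1) * u = (1 - u) * 1 + u * expR l by ring.
by rewrite lerD// ler_wpM2l// subr_ge0.
Qed.

(** The logarithm of [b] has derivative [p], the mean of the tilted Bernoulli law, and
    [p' = p * (1 - p) <= 1 / 4]; integrating twice gives [l ^+ 2 / 8]. *)
Lemma bernoulli_mgf (m l : R) : 0 <= m <= 1 -> 0 <= l ->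
  1 + (expR l - 1) * m <= expR (l * m + l ^+ 2 / 8).
Proof.
move=> /andP[m0 m1] l0.
pose b x := 1 + (expR x - 1) * m.
have b0 x : 0 < b x.
  have -> : b x = (1 - m) + expR x * m by rewrite /b; ring.
  move: m0; rewrite le_eqVlt => /predU1P[<-|mp]; first by rewrite mulr0 addr0 subr0.
  by rewrite ltr_wpDl ?subr_ge0// mulr_gt0 ?expR_gt0.
have bD (x : R) : is_derive x 1 b (expR x * m).
  rewrite /b; apply: is_derive_eq; rewrite /GRing.scale/=; ring.
pose p x := expR x * m / b x.
have pD (x : R) : is_derive x 1 p (p x * (1 - p x)).
  have d1 : is_derive x 1 (fun x => expR x * m) (expR x * m).
    by apply: is_derive_eq; rewrite /GRing.scale/=; ring.
  have d2 : is_derive x 1 (fun x => (b x)^-1) (- (b x) ^- 2 *: (expR x * m)).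
    by apply: is_deriveV; rewrite ?gt_eqF.
  have := is_deriveM d1 d2; rewrite /GRing.scale/=.
  set v := (X in is_derive x 1 _ X -> _); suff -> : v = p x * (1 - p x) by [].
  rewrite /v /p; have := b0 x; move: (b x) (expR x * m) => B E B0.
  by field; rewrite gt_eqF.
have q0 x : 0 <= x -> 0 <= m + x / 4 - p x.
  move=> x0; pose f x := m + x / 4 - p x.
  have fD (y : R) : 0 <= y <= x -> is_derive y 1 f (1 / 4 - p y * (1 - p y)).
    move=> _; have dp := pD y.
    rewrite /f; apply: is_derive_eq; rewrite /GRing.scale/=; lra.
  rewrite -/(f x); suff <- : f 0 = 0.
    apply: (derive_ge0_le x0 fD) => y _.
    by have := sqr_ge0 (p y - 1 / 2); lra.
  by rewrite /f /p /b expR0 subrr !mul0r !addr0 mul1r divr1 subrr.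
pose F x := m * x + x ^+ 2 / 8 - ln (b x).
have FD (y : R) : 0 <= y <= l -> is_derive y 1 F (m + y / 4 - p y).
  move=> _; have dl : is_derive y 1 (fun x => ln (b x)) (p y).
    have := @is_derive1_comp R (@ln R) b y _ _ (is_derive1_ln (b0 y)) (bD y).
    by rewrite mulrC.
  rewrite /F; apply: is_derive_eq; rewrite /GRing.scale/=; lra.
have F0 : F 0 = 0.
  by rewrite /F mulr0 expr0n/= mul0r addr0 /b expR0 subrr mul0r addr0 ln1 subr0.
have : F 0 <= F l.
  by apply: (derive_ge0_le l0 FD) => y /andP[y0 _]; exact: q0.
rewrite F0 /F subr_ge0 => h.
by rewrite -/(b l) -[leLHS]lnK ?posrE// ler_expR (mulrC l).
Qed.

Lemma integral_cst01 (k : R) : (\int[leb]_(x in I01) k%:E = k%:E)%E.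
Proof.
by rewrite integral_cst//= lebesgue_measure_itv/= lte_fin ltr01 oppr0 adde0 mule1.
Qed.

Lemma hoeffding01 (u : R -> R) (m l : R) : measurable_fun I01 u ->
  (forall x, 0 <= u x <= 1) -> (\int[leb]_(x in I01) (u x)%:E = m%:E)%E -> 0 <= l ->
  (\int[leb]_(x in I01) (expR (l * u x))%:E <= (expR (l * m + l ^+ 2 / 8))%:E)%E.
Proof.
move=> mu u01 um l0.
have el : 0 <= expR l - 1 by rewrite subr_ge0 -expR0 ler_expR.
have m01 : 0 <= m <= 1.
  rewrite -!lee_fin -um integral_ge0//=; last by move=> x _; rewrite lee_fin; case/andP: (u01 x).
  rewrite -(integral_cst01 1); apply: ge0_le_integral => //.
  - by move=> x _; rewrite lee_fin; case/andP: (u01 x).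
  - exact/measurable_EFinP.
  - by move=> x _; rewrite lee_fin; case/andP: (u01 x).
apply: (@le_trans _ _ (\int[leb]_(x in I01) (1%:E + (expR l - 1)%:E * (u x)%:E))%E).
  apply: ge0_le_integral => //.
  - apply/measurable_EFinP; apply: measurableT_comp => //.
    exact: measurable_funM.
  - apply: emeasurable_funD => //; apply: measurable_funeM.
    exact/measurable_EFinP.
  - move=> x _; rewrite -EFinM -EFinD lee_fin.
    exact: expR_chord.
rewrite ge0_integralD//; last 2 first.
- by move=> x _; rewrite mule_ge0 ?lee_fin//; case/andP: (u01 x).
- by apply: measurable_funeM; exact/measurable_EFinP.
rewrite integral_cst01 ge0_integralZl_EFin//; last 2 first.
- by move=> x _; rewrite lee_fin; case/andP: (u01 x).
- exact/measurable_EFinP.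
by rewrite um -EFinM -EFinD lee_fin bernoulli_mgf.
Qed.

(** A rescaled logarithm [u] of [t], with values in [0, 1], controls both functions: [s] is at most
    a constant times [expR (al * u)], and [t] at most a constant times [expR (be * (1 - u))].
    Hoeffding's lemma is applied to [u] and to [1 - u], whose means cancel in the sum. *)
Lemma hamming_1d (s t : R -> R) (al be K S T : R) : 0 < al -> 0 < be ->
  measurable_fun I01 s -> measurable_fun I01 t ->
  (forall x, 0 <= s x) -> (forall x, 0 <= t x <= 1) ->
  (forall x y, 0 < s x -> 0 < t y -> ln (s x) / al + ln (t y) / be <= K + (x != y)%:R) ->
  (\int[leb]_(x in I01) (s x)%:E = S%:E)%E -> (\int[leb]_(x in I01) (t x)%:E = T%:E)%E ->
  0 < S -> 0 < T -> ln S / al + ln T / be <= K + (al + be) / 8.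
Proof.
move=> al0 be0 ms mt s0 t01 H intS intT S0 T0.
pose tau := sup (range t).
have tub : has_ubound (range t) by exists 1 => _ [x _ <-]; case/andP: (t01 x).
have tle x : t x <= tau by apply: ub_le_sup => //; exists x.
have tau0 : 0 < tau.
  rewrite ltNge; apply/negP => tau0.
  have : (T%:E <= 0)%E.
    rewrite -intT integral0_eq// => x _; congr EFin; apply/le_anti.
    by rewrite (le_trans (tle x) tau0); case/andP: (t01 x).
  by rewrite lee_fin leNgt T0.
(* Comparing [x] with all [y], at cost at most 1, bounds [s x] through the supremum [tau]; this
   serves where [t x] is too small to compare with. *)
have hs x : 0 < s x -> ln (s x) / al <= K + 1 - ln tau / be.
  move=> sx0.
  suff h : tau <= expR (be * (K + 1 - ln (s x) / al)).
    have : ln tau <= be * (K + 1 - ln (s x) / al).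
      by rewrite -(expRK (be * _)) ler_ln ?posrE ?expR_gt0.
    by rewrite -ler_pdivrMl// mulrC; lra.
  apply: ge_sup; first by exists (t 0), 0.
  move=> _ [y _ <-] /=; have [ty0|y0] := leP (t y) 0.
    by rewrite (le_trans ty0)// expR_ge0.
  rewrite -[leLHS]lnK ?posrE// ler_expR -ler_pdivrMl// mulrC.
  have := H x y sx0 y0; case: (x != y) => /=; lra.
(* Truncating [t] from below at [expR (- be) * tau] keeps [u] at most 1 and covers the points where
   [t] vanishes. *)
pose w x := Num.max (t x) (expR (- be) * tau).
have w0 x : 0 < w x by rewrite lt_max orbC mulr_gt0 ?expR_gt0.
have wtau x : w x <= tau.
  by rewrite ge_max tle ger_pMl//= -expR0 ler_expR oppr_le0 ltW.
pose u x := (ln tau - ln (w x)) / be.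
have u01 x : 0 <= u x <= 1.
  rewrite divr_ge0 ?(ltW be0)//=; last by rewrite subr_ge0 ler_ln ?posrE.
  rewrite ler_pdivrMr// mul1r lerBlDr -lerBlDl.
  have -> : ln tau - be = ln (expR (- be) * tau).
    by rewrite lnM ?posrE ?expR_gt0// expRK addrC.
  by rewrite ler_ln ?posrE// ?mulr_gt0 ?expR_gt0// le_max lexx orbT.
have mu : measurable_fun I01 u.
  apply: measurable_funM => //; apply: measurable_funB => //.
  apply: measurableT_comp => //; exact: measurable_maxr.
have um : (\int[leb]_(x in I01) (u x)%:E = (fine (\int[leb]_(x in I01) (u x)%:E))%:E)%E.
  rewrite fineK// ge0_fin_numE; last first.
    by apply: integral_ge0 => x _; rewrite lee_fin; case/andP: (u01 x).
  apply: (@le_lt_trans _ _ (\int[leb]_(x in I01) 1%:E)%E); last by rewrite integral_cst01 ltry.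
  apply: ge0_le_integral => //.
  - by move=> x _; rewrite lee_fin; case/andP: (u01 x).
  - exact/measurable_EFinP.
  - by move=> x _; rewrite lee_fin; case/andP: (u01 x).
move: um; set m := fine _ => um.
have vm : (\int[leb]_(x in I01) (1 - u x)%:E = (1 - m)%:E)%E.
  have : (\int[leb]_(x in I01) (1 - u x)%:E + \int[leb]_(x in I01) (u x)%:E = 1%:E)%E.
    rewrite -(integral_cst01 1) -ge0_integralD//.
    - by apply: eq_integral => x _; rewrite -EFinD subrK.
    - by move=> x _; rewrite lee_fin subr_ge0; case/andP: (u01 x).
    - by apply/measurable_EFinP; apply: measurable_funB.
    - by move=> x _; rewrite lee_fin; case/andP: (u01 x).
    - exact/measurable_EFinP.
  rewrite um; case: (\int[leb]_(x in I01) _)%E => // v [<-].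
  by rewrite addrK.
have bS : S <= expR (al * (K - ln tau / be)) * expR (al * m + al ^+ 2 / 8).
  rewrite -lee_fin -intS EFinM.
  apply: le_trans (_ : (expR (al * (K - ln tau / be)))%:E *
    \int[leb]_(x in I01) (expR (al * u x))%:E <= _)%E; last first.
    by rewrite lee_pmul2l//= ?lte_fin ?expR_gt0//; apply: hoeffding01 => //; exact: ltW.
  rewrite -ge0_integralZl_EFin ?expR_ge0//; last first.
    by apply/measurable_EFinP; apply: measurableT_comp => //; exact: measurable_funM.
  apply: ge0_le_integral => //.
  - by move=> x _; rewrite lee_fin.
  - exact/measurable_EFinP.
  - apply: measurable_funeM; apply/measurable_EFinP; apply: measurableT_comp => //.
    exact: measurable_funM.
  move=> x _; rewrite -EFinM lee_fin -expRD.
  have [xs0|sx0] := leP (s x) 0; first by rewrite (le_trans xs0)// expR_ge0.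
  rewrite -[leLHS]lnK ?posrE// ler_expR -mulrDr -ler_pdivrMl// mulrC.
  rewrite /u /w; case: (leP (t x) (expR (- be) * tau)) => tx.
    rewrite lnM ?posrE ?expR_gt0// expRK.
    have -> : (ln tau - (- be + ln tau)) / be = 1 by field; rewrite gt_eqF.
    by have := hs x sx0; lra.
  have tx0 : 0 < t x by apply: lt_trans tx; rewrite mulr_gt0 ?expR_gt0.
  have := H x x sx0 tx0; rewrite eqxx /= mulrBl; lra.
have bT : T <= tau * expR (- be) * expR (be * (1 - m) + be ^+ 2 / 8).
  rewrite -lee_fin -intT EFinM.
  apply: le_trans (_ : (tau * expR (- be))%:E *
    \int[leb]_(x in I01) (expR (be * (1 - u x)))%:E <= _)%E; last first.
    rewrite lee_pmul2l//= ?lte_fin ?mulr_gt0 ?expR_gt0//; apply: hoeffding01 => //.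
    - exact: measurable_funB.
    - by move=> x; have := u01 x; lra.
    - exact: ltW.
  have mv : measurable_fun I01 (EFin \o (fun x => expR (be * (1 - u x)))).
    apply/measurable_EFinP; apply: measurableT_comp => //; apply: measurable_funM => //.
    exact: measurable_funB.
  rewrite -ge0_integralZl_EFin ?mulr_ge0 ?expR_ge0 ?(ltW tau0)//.
  apply: ge0_le_integral => //.
  - by move=> x _; rewrite lee_fin; case/andP: (t01 x).
  - exact/measurable_EFinP.
  - exact: measurable_funeM.
  move=> x _; rewrite -EFinM lee_fin.
  have -> : tau * expR (- be) * expR (be * (1 - u x)) = w x.
    rewrite -mulrA -expRD -[in LHS](lnK (x := tau)) ?posrE// -expRD -[RHS]lnK ?posrE//.
    congr expR; rewrite /u; move: (ln tau) (ln (w x)) => p q; field; rewrite gt_eqF//.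
  by rewrite le_max lexx.
have lS : ln S / al <= K - ln tau / be + m + al / 8.
  rewrite ler_pdivrMr// -ler_expR lnK ?posrE//; apply: le_trans bS _.
  rewrite -expRD ler_expR; lra.
have lT : ln T / be <= ln tau / be - m + be / 8.
  rewrite ler_pdivrMr// -ler_expR lnK ?posrE//; apply: le_trans bT _.
  rewrite -[X in X * _ * _](lnK (x := tau)) ?posrE// -!expRD ler_expR.
  have -> : (ln tau / be - m + be / 8) * be = ln tau - m * be + be ^+ 2 / 8.
    by move: (ln tau) => p; field; rewrite gt_eqF.
  lra.
lra.
Qed.

Definition hdist n (x y : n.-tuple R) : nat := \sum_(i < n) (tnth x i != tnth y i).

Lemma hdist_cons n a b (x y : n.-tuple R) :
  hdist (cons_tuple a x) (cons_tuple b y) = ((a != b) + hdist x y)%N.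
Proof.
rewrite /hdist big_ord_recl !tnth0; congr (_ + _)%N.
by apply: eq_bigr => i _; rewrite !tnthS.
Qed.

Lemma lvol_le1 n (A : set (n.-tuple R)) : measurable A -> A `<=` @cube R n -> (lvol A <= 1)%E.
Proof.
move=> mA Ac; rewrite -(lvol_cube n).
by apply: le_measure; rewrite ?inE//; exact: measurable_cube.
Qed.

Lemma lvol_int01 n (A : set (n.+1.-tuple R)) : A `<=` @cube R n.+1 ->
  (lvol A = \int[leb]_(x in I01) lvol [set t : n.-tuple R | A (cons_tuple x t)])%E.
Proof.
move=> Ac; rewrite lvolS [RHS]integral_mkcond; apply: eq_integral => x _.
rewrite patchE; case: ifPn => //; rewrite notin_setE /= in_itv/= => x01.
rewrite (_ : [set _ | _] = set0) ?lvol_set0//.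
by apply/seteqP; split=> t // /Ac/cube_cons[].
Qed.

(** Induction on sections: those of [S] at [x] and of [D] at [y] remain [e - (x != y)] apart, so
    their volumes satisfy the hypothesis of [hamming_1d]. *)
Lemma hamming_sets n (S D : set (n.-tuple R)) (al be e : R) : 0 < al -> 0 < be ->
  measurable S -> measurable D -> S `<=` @cube R n -> D `<=` @cube R n ->
  (forall x y, S x -> D y -> e <= (hdist x y)%:R) ->
  (0 < lvol S)%E -> (0 < lvol D)%E ->
  ln (fine (lvol S)) / al + ln (fine (lvol D)) / be <= n%:R * ((al + be) / 8) - e.
Proof.
move=> al0 be0; elim: n S D e => [|n IH] S D e mS mD Sc Dc sep /=.
  case: ifPn => [/asboolP Sn|]; last by rewrite ltxx.
  case: ifPn => [/asboolP Dn|]; last by rewrite ltxx.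
  move=> _ _; have := sep _ _ Sn Dn; rewrite /hdist big_ord0 ln1; lra.
rewrite -!lvolS => S0 D0.
pose sec (A : set (n.+1.-tuple R)) x : set (n.-tuple R) := [set t | A (cons_tuple x t)].
have msec A x : measurable A -> measurable (sec A x) by exact: measurable_section.
have csec A x : A `<=` @cube R n.+1 -> sec A x `<=` @cube R n.
  by move=> Ac t /Ac/cube_cons[].
have fsec A x : measurable A -> A `<=` @cube R n.+1 -> lvol (sec A x) \is a fin_num.
  move=> mA Ac; rewrite ge0_fin_numE ?lvol_ge0//.
  by rewrite (le_lt_trans (lvol_le1 (msec _ x mA) (csec _ x Ac)))// ltry.
have fA A : measurable A -> A `<=` @cube R n.+1 -> lvol A \is a fin_num.
  move=> mA Ac; rewrite ge0_fin_numE ?lvol_ge0//.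
  by rewrite (le_lt_trans (lvol_le1 mA Ac))// ltry.
pose s A x := fine (lvol (sec A x)).
have int A : measurable A -> A `<=` @cube R n.+1 ->
    (\int[leb]_(x in I01) (s A x)%:E = (fine (lvol A))%:E)%E.
  move=> mA Ac; rewrite fineK ?fA// lvol_int01//.
  by apply: eq_integral => x _; rewrite fineK// fsec.
have ms A : measurable A -> measurable_fun I01 (s A).
  move=> mA; apply: measurable_funTS.
  by apply: (measurableT_comp (fine_measurable measurableT)); exact: measurable_lvol_section.
have pos A : measurable A -> A `<=` @cube R n.+1 -> (0 < lvol A)%E -> 0 < fine (lvol A).
  by move=> mA Ac A0; rewrite fine_gt0// A0/= ltey_eq fA.
rewrite -natr1 mulrDl mul1r addrAC.
apply: (@hamming_1d (s S) (s D) al be _ _ _ al0 be0 (ms S mS) (ms D mD)).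
- by move=> x; rewrite fine_ge0// lvol_ge0.
- move=> x; rewrite fine_ge0 ?lvol_ge0//= -lee_fin fineK ?fsec//.
  exact: lvol_le1 (msec _ _ mD) (csec _ _ Dc).
- move=> x y sx sy.
  have px : (0 < lvol (sec S x))%E by rewrite -[X in (_ < X)%E]fineK ?fsec// lte_fin.
  have py : (0 < lvol (sec D y))%E by rewrite -[X in (_ < X)%E]fineK ?fsec// lte_fin.
  have sep' u v : sec S x u -> sec D y v -> e - (x != y)%:R <= (hdist u v)%:R.
    by move=> Su Dv; have := sep _ _ Su Dv; rewrite hdist_cons natrD; lra.
  have := IH _ _ _ (msec _ x mS) (msec _ y mD) (csec _ x Sc) (csec _ y Dc) sep' px py.
  by rewrite opprB addrA addrAC.
- exact: int.
- exact: int.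
- exact: pos.
- exact: pos.
Qed.

End Hamming.

(** * Comparison of distances and conclusion *)

Section Final.
Context {R : realType}.

Lemma sqd_tnth n (x y : n.-tuple R) :
  sqd n (nth 0 x) (nth 0 y) = \sum_(i < n) (tnth x i - tnth y i) ^+ 2.
Proof. by apply: eq_bigr => i _; rewrite !(tnth_nth 0). Qed.

Lemma powR_bernoulli (t q : R) : 0 <= t -> 0 < q <= 1 -> powR t q <= 1 + (t - 1) * q.
Proof.
move=> t0 /andP[q0 q1]; move: t0; rewrite le_eqVlt => /predU1P[<-|t0].
  by rewrite powR0 ?gt_eqF// sub0r mulN1r subr_ge0.
rewrite /powR gt_eqF// mulrC -{2}(lnK (x := t)) ?posrE//.
by apply: expR_chord; rewrite ltW.
Qed.

(* [M] is the common value of the coordinates in the extremal case *)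
Lemma sum_powR_le_lt2 n (p M : R) (a : 'I_n -> R) : 0 < p <= 2 -> 0 < M -> (forall i, 0 <= a i) ->
  \sum_i a i ^+ 2 <= n%:R * M ^+ 2 -> \sum_i powR (a i) p <= n%:R * powR M p.
Proof.
move=> /andP[p0 p2] M0 a0 h.
have M2 : 0 < M ^+ 2 by exact: exprn_gt0.
(* The concave power [p / 2] of [a i ^+ 2 / M ^+ 2] lies below its tangent at 1. *)
apply: (@le_trans _ _ (\sum_i powR M p * (1 + (a i ^+ 2 / M ^+ 2 - 1) * (p / 2)))).
  apply: ler_sum => i _.
  have -> : powR (a i) p = powR M p * powR (a i ^+ 2 / M ^+ 2) (p / 2).
    have -> : a i ^+ 2 / M ^+ 2 = powR (a i / M) 2%:R.
      by rewrite powR_mulrn ?divr_ge0 ?(ltW M0)// expr_div_n.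
    rewrite -powRrM.
    rewrite (_ : 2%:R * (p / 2) = p); last by field.
    by rewrite -powRM ?divr_ge0 ?(ltW M0)// mulrC divfK ?gt_eqF.
  rewrite ler_wpM2l ?powR_ge0// powR_bernoulli//; first by rewrite divr_ge0// ?sqr_ge0 ?ltW.
  by rewrite divr_gt0//= ler_pdivrMr// mul1r.
rewrite -mulr_sumr mulrC ler_wpM2r ?powR_ge0//.
rewrite big_split/= sumr_const card_ord -mulr_suml sumrB -mulr_suml sumr_const card_ord.
rewrite gerDl mulr_le0_ge0//; last by rewrite divr_ge0// ltW.
by rewrite subr_le0 ler_pdivrMr.
Qed.

Lemma sum_powR_le_ge2 n (p M : R) (a : 'I_n -> R) : 2 <= p -> 0 < M -> (forall i, 0 <= a i) ->
  \sum_i a i ^+ 2 <= M ^+ 2 -> \sum_i powR (a i) p <= powR M p.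
Proof.
move=> p2 M0 a0 h.
have M2 : 0 < M ^+ 2 by exact: exprn_gt0.
have aM i : a i <= M.
  rewrite -(ler_pXn2r (n := 2))// ?nnegrE ?(ltW M0)//; apply: le_trans h.
  by rewrite (bigD1 i)//= lerDl; apply: sumr_ge0 => j _; exact: sqr_ge0.
apply: (@le_trans _ _ (\sum_i powR M p * (a i ^+ 2 / M ^+ 2))).
  apply: ler_sum => i _.
  have -> : powR (a i) p = powR M p * powR (a i / M) p.
    by rewrite -powRM ?divr_ge0 ?(ltW M0)// mulrC divfK ?gt_eqF.
  have -> : a i ^+ 2 / M ^+ 2 = powR (a i / M) 2%:R.
    by rewrite powR_mulrn ?divr_ge0 ?(ltW M0)// expr_div_n.
  rewrite ler_wpM2l ?powR_ge0//.
  have := a0 i; rewrite le_eqVlt => /predU1P[<-|ai0].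
    by rewrite mul0r !powR0// gt_eqF// (lt_le_trans _ p2).
  by rewrite ger_powR// divr_gt0//= ler_pdivrMr// mul1r.
by rewrite -mulr_sumr -mulr_suml ger_pMr ?powR_gt0// ler_pdivrMr// mul1r.
Qed.

(** For [p <= 2] the exponent is the cost of bounding the [p]-norm by the Euclidean norm, attained
    at equal coordinates; for [p >= 2] it is 0, the [p]-norm being the smaller one. *)
Lemma pdist_le n (p eps : R) (x y : n.-tuple R) : (0 < n)%N -> 0 < p -> 0 < eps ->
  sqd n (nth 0 x) (nth 0 y) <= eps ^+ 2 * powR n%:R (1 - 2 / Num.min p 2) ->
  pdist p x y <= eps.
Proof.
move=> n0 p0 e0; rewrite sqd_tnth => h.
have nR : 0 < n%:R :> R by rewrite ltr0n.
rewrite /pdist gt_eqF//.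
suff hs : \sum_(i < n) powR `|tnth x i - tnth y i| p <= powR eps p.
  have -> : eps = powR (powR eps p) p^-1 by rewrite -powRrM mulfV ?gt_eqF// powRr1// ltW.
  apply: ge0_ler_powR => //; rewrite ?nnegrE ?invr_ge0 ?powR_ge0 ?(ltW p0)//.
  by apply: sumr_ge0 => i _; exact: powR_ge0.
have h' : \sum_(i < n) `|tnth x i - tnth y i| ^+ 2 <= eps ^+ 2 * powR n%:R (1 - 2 / Num.min p 2).
  by under eq_bigr do rewrite real_normK ?num_real//.
have [p2|p2] := leP p 2; last first.
  apply: sum_powR_le_ge2 => //; first exact: ltW.
  by move: h'; rewrite min_r ?(ltW p2)// divff// subrr powRr0 mulr1.
pose M := eps * powR n%:R (- p^-1).
have M0 : 0 < M by rewrite mulr_gt0// powR_gt0.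
have -> : powR eps p = n%:R * powR M p.
  rewrite /M powRM ?(ltW e0) ?powR_ge0// -powRrM mulNr mulVf ?gt_eqF//.
  by rewrite powR_inv1 ?(ltW nR)// mulrCA divff ?mulr1// gt_eqF.
apply: sum_powR_le_lt2 => //; first by rewrite p0.
apply: le_trans h' _; rewrite min_l// /M exprMn mulrCA ler_wpM2l ?sqr_ge0//.
rewrite -(powR_mulrn 2) ?powR_ge0// -powRrM -{2}(powRr1 (ltW nR)) -powRD; last first.
  by rewrite pnatr_eq0 -lt0n n0 implybT.
by rewrite (_ : 1 - 2 / p = 1 + - p^-1 * 2%:R)//; ring.
Qed.

Lemma vol_cover n (A : set (n.-tuple R)) (v : \bar R) : (vol A < v)%E ->
  exists B, [/\ measurable B, A `<=` B & (lvol B < v)%E].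
Proof. by move=> /ereal_inf_lt[_ [B [mB AB] <-] Bv]; exists B. Qed.

Lemma vol_le n (A B : set (n.-tuple R)) : measurable B -> A `<=` B -> (vol A <= lvol B)%E.
Proof. by move=> mB AB; apply: ereal_inf_lbound; exists B. Qed.

(** The support need not be Borel. The positivity set of the Borel representative, minus a Borel
    null set, gives a Borel subset of no smaller volume, as required by integration over
    sections. *)
Lemma density_supp n (rho : n.-tuple R -> R) : is_density rho ->
  exists S, [/\ measurable S, S `<=` supp rho & (vol (supp rho) <= lvol S)%E].
Proof.
move=> [_ [g [mg [[N [mN [N0 hN]]] _]]]].
pose G := @cube R n `&` g @^-1` `]0, +oo[.
have mG : measurable G by apply: mg => //; exact: measurable_cube.
have mS : measurable (G `\` N) by exact: measurableD.
have rg x : cube x -> ~ N x -> rho x = g x.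
  by move=> cx Nx; apply: contrapT => ne; apply/Nx/hN.
exists (G `\` N); split=> //.
  move=> x [[cx /=]]; rewrite in_itv/= andbT => gx Nx.
  by split=> //; rewrite rg.
apply: (@le_trans _ _ (lvol ((G `\` N) `|` N))).
  apply: vol_le; first exact: measurableU.
  move=> x [cx rx]; have [Nx|Nx] := pselect (N x); first by right.
  by left; split=> //; split=> //=; rewrite in_itv/= andbT -rg.
apply: le_trans (measureU2 _ _ _) _ => //.
by rewrite [X in (_ + X)%E]N0 adde0.
Qed.

Lemma hamming_isoperimetry n (B S : set (n.-tuple R)) (eps : R) : (0 < n)%N ->
  let sig := Num.sqrt (n%:R * ln 2 / 2) in
  measurable B -> (lvol B < (1 / 2)%:E)%E -> measurable S -> S `<=` @cube R n ->
  sig <= eps ->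
  (forall x y, S x -> cube y -> ~ B y -> eps <= (hdist x y)%:R) ->
  (lvol S < (expR (- (2 / n%:R * (eps - sig) ^+ 2)))%:E)%E.
Proof.
move=> n0 sig mB hB mS Sc se sep; rewrite ltNge; apply/negP => hS.
have nR : 0 < n%:R :> R by rewrite ltr0n.
have ln20 : 0 < ln 2 :> R by rewrite ln_gt0// ltr1n.
have sig0 : 0 < sig by rewrite sqrtr_gt0 divr_gt0// mulr_gt0.
have sig2 : ln 2 = 2 * sig ^+ 2 / n%:R.
  rewrite sqr_sqrtr; first by move: (ln 2) => l; field; rewrite gt_eqF.
  by rewrite divr_ge0// mulr_ge0// ltW.
pose t := eps - sig.
have t0 : 0 <= t by rewrite subr_ge0.
pose D := @cube R n `\` B.
have mD : measurable D by apply: measurableD => //; exact: measurable_cube.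
have Dc : D `<=` @cube R n by move=> x [].
have fB : lvol B \is a fin_num by rewrite ge0_fin_numE ?lvol_ge0// (lt_trans hB) ?ltry.
have fD : lvol D \is a fin_num.
  by rewrite ge0_fin_numE ?lvol_ge0// (le_lt_trans (lvol_le1 mD Dc))// ltry.
have fS : lvol S \is a fin_num.
  by rewrite ge0_fin_numE ?lvol_ge0// (le_lt_trans (lvol_le1 mS Sc))// ltry.
have D2 : 1 / 2 < fine (lvol D).
  have : (lvol (@cube R n) <= lvol (D `|` B))%E.
    apply: le_measure; rewrite ?inE; [exact: measurable_cube|exact: measurableU|].
    by move=> x cx; have [Bx|Bx] := pselect (B x); [right|left].
  have B2 : fine (lvol B) < 1 / 2 by rewrite -lte_fin fineK.
  rewrite lvol_cube => h; have := le_trans h (measureU2 _ mD mB).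
  rewrite -[X in (_ <= X + _)%E](fineK fD) -[X in (_ <= _ + X)%E](fineK fB) -EFinD lee_fin.
  by move: B2; clear; lra.
have S2 : expR (- (2 / n%:R * t ^+ 2)) <= fine (lvol S) by rewrite -lee_fin fineK.
have S0 : 0 < fine (lvol S) by apply: lt_le_trans S2; exact: expR_gt0.
have lS : - (2 / n%:R * t ^+ 2) <= ln (fine (lvol S)).
  by rewrite -[leLHS]expRK ler_ln ?posrE ?expR_gt0.
have D0 : 0 < fine (lvol D) by apply: lt_trans D2; lra.
have lD : - ln 2 < ln (fine (lvol D)).
  by rewrite -lnV ?posrE// ltr_ln ?posrE// -[ltLHS]mul1r.
(* The minimiser of [ln 2 / be + n * be / 8], a set of volume 1/2 being the limiting case for
   [D]. *)
pose be := 4 * sig / n%:R.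
have be0 : 0 < be by rewrite divr_gt0// mulr_gt0.
pose gap := (ln (fine (lvol D)) + ln 2) / be.
have gap0 : 0 < gap by rewrite divr_gt0//; lra.
(* The optimum would be [4 * t / n]. Adding [gap], the slack of [D] over volume 1/2, keeps [al]
   positive when [t = 0] and still leaves [gap / 2] for the contradiction. *)
pose al := 4 * (t + gap) / n%:R.
have al0 : 0 < al by rewrite divr_gt0// mulr_gt0// ltr_wpDl.
have sep' x y : S x -> D y -> eps <= (hdist x y)%:R by move=> Sx [cy By]; exact: sep.
have := hamming_sets al0 be0 mS mD Sc Dc sep'.
rewrite -(fineK fS) -(fineK fD) !lte_fin => /(_ S0 D0) /=.
have e1 : ln (fine (lvol D)) / be = gap - sig / 2.
  rewrite /gap mulrDl sig2 /be.
  by field; rewrite !gt_eqF.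
have e2 : n%:R * ((al + be) / 8) = (t + gap) / 2 + sig / 2.
  by rewrite /al /be; field; rewrite gt_eqF.
have e3 : - (t / 2) <= ln (fine (lvol S)) / al.
  rewrite ler_pdivlMr//; apply: le_trans lS.
  rewrite mulNr lerN2 /al.
  have -> : t / 2 * (4 * (t + gap) / n%:R) = 2 / n%:R * t ^+ 2 + 2 / n%:R * (t * gap).
    by field; rewrite gt_eqF.
  rewrite lerDl; apply: mulr_ge0; first by rewrite divr_ge0// ltW.
  by apply: mulr_ge0 => //; exact: ltW.
rewrite e1 e2; move: e3 gap0; rewrite /t; clear; lra.
Qed.

Lemma pdist0 n (x y : n.-tuple R) : pdist 0 x y = (hdist x y)%:R.
Proof.
rewrite /pdist eqxx /hdist; congr (_%:R); rewrite -sum1_card big_mkcond/=.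
apply: eq_bigr => i _.
rewrite (_ : (i \in _) = (tnth x i != tnth y i)); first by case: (_ == _).
by rewrite -subr_eq0; apply/idP/idP; rewrite inE.
Qed.

End Final.

(* Classes {1,...,m} are represented by 'I_m = {0,...,m-1}. *)
Theorem theorem4 (R : realType) (n m : nat) (hn : (1 <= n)%N)
  (rho : 'I_m -> n.-tuple R -> R)
  (hrho : forall c, is_density (rho c))
  (hbdd : forall c, bounded_on_cube (rho c))
  (C : n.-tuple R -> 'I_m)
  (hC : forall k, lmeasurable (@cube R n `&` C @^-1` [set k]))
  (c : 'I_m)
  (hfc : (vol (@cube R n `&` C @^-1` [set c]) < (1 / 2)%:E)%E)
  (p : R) (hp : 0 <= p) (eps : R) (heps : 0 < eps) :
  ((0 < p /\
     ((1 / 2 * expR (- (pi * eps ^+ 2 * powR n%:R (1 - 2 / Num.min p 2))))%:E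
        <= vol (supp (rho c)))%E)
   \/
   (p = 0 /\ Num.sqrt (n%:R * ln 2 / 2) <= eps /\
     ((expR (- (2 / n%:R * (eps - Num.sqrt (n%:R * ln 2 / 2)) ^+ 2)))%:E
        <= vol (supp (rho c)))%E)) ->
  exists x xh : n.-tuple R,
    cube x /\ 0 < rho c x /\ cube xh /\ C xh <> c /\ pdist p x xh <= eps.
Proof.
move=> hv; apply: contrapT => no.
have far x y : supp (rho c) x -> cube y -> C y <> c -> eps < pdist p x y.
  move=> [cx rx] cy Cy; rewrite ltNge; apply/negP => h.
  by apply: no; exists x, y.
have [B [mB CB hB]] := vol_cover hfc.
have notB y : cube y -> ~ B y -> C y <> c by move=> cy By Cy; apply/By/CB.
have nR : 0 < n%:R :> R by rewrite ltr0n.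
case: hv => [[p0 hv]|[p0 [se hv]]].
  (* The Euclidean radius that forces [pdist p] to be at most [eps]; then [pi * r ^+ 2] is the
     exponent of the hypothesis. *)
  pose r := Num.sqrt (eps ^+ 2 * powR n%:R (1 - 2 / Num.min p 2)).
  have rr : 0 < eps ^+ 2 * powR n%:R (1 - 2 / Num.min p 2).
    by rewrite mulr_gt0 ?exprn_gt0 ?powR_gt0.
  have r2 : r ^+ 2 = eps ^+ 2 * powR n%:R (1 - 2 / Num.min p 2) by rewrite sqr_sqrtr ?ltW.
  have r0 : 0 < r by rewrite sqrtr_gt0.
  have Sc : supp (rho c) `<=` @cube R n by move=> x [].
  have sep x y : supp (rho c) x -> cube y -> ~ B y -> r ^+ 2 <= sqd n (nth 0 x) (nth 0 y).
    move=> sx cy By; rewrite leNgt; apply/negP => h.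
    have := far _ _ sx cy (notB _ cy By).
    by rewrite ltNge pdist_le// -r2 ltW.
  have := cube_isoperimetry mB hB r0 Sc sep.
  by rewrite /phi r2 mulrA ltNge hv.
have [S [mS Ssupp Sv]] := density_supp (hrho c).
have Sc : S `<=` @cube R n by move=> x /Ssupp[].
have sep x y : S x -> cube y -> ~ B y -> eps <= (hdist x y)%:R.
  by move=> /Ssupp Sx cy By; rewrite -pdist0 -p0 ltW// far//; exact: notB.
have := hamming_isoperimetry hn mB hB mS Sc se sep.
by rewrite ltNge (le_trans hv Sv).
Qed.
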